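(* Assume $W_c$ satisfies Assumption 2. Then for all integers $k,n\ge2$, \[ \log P_j(k,n)\le\inf_{s\in(0,\frac12]}\left[\frac{-nsR+(n-1)\,U\big[W_s,W_c,\uparrow;\tfrac{k-1}{n-1}\big](s)}{1-s}+\frac{\overline\xi_{W_s}(s)+\overline\xi_{W_c}(s)}{1-s}\right]. \]
   Context: Setup. $\mathcal M$ is a finite set and $W_s=\{W_s(m|m')\}$ an irreducible aperiodic transition matrix on $\mathcal M$; the message $M^k$ has law $P_{M^k}(m^k)=P_{M_1}(m_1)\prod_{i=2}^kW_s(m_i|m_{i-1})$ for an initial distribution $P_{M_1}$. $\mathcal X$ is a finite abelian group, $\mathcal Z$ a finite set, $W_c=\{W_c(x,z|x',z')\}$ an irreducible aperiodic transition matrix on $\mathcal X\times\mathcal Z$, and $(X^n,Z^n)$ has law $P_{X^nZ^n}(x^n,z^n)=P_{X_1Z_1}(x_1,z_1)\prod_{i=2}^nW_c(x_i,z_i|x_{i-1},z_{i-1})$ for an initial distribution $P_{X_1Z_1}$. The channel maps input $\tilde x^n\in\mathcal X^n$ to output $(x^n,z^n)$ with probability $P_{X^nZ^n}(x^n-\tilde x^n,z^n)$. A code is $(\mathsf e,\mathsf d)$ with $\mathsf e:\mathcal M^k\to\mathcal X^n$, $\mathsf d:(\mathcal X\times\mathcal Z)^n\to\mathcal M^k$; $P_j(k,n)$ is the infimum over codes of the average (over $P_{M^k}$) decoding error probability. $R:=\log|\mathcal X|$. Assumption 2: either (i) for every $\theta\in(-\infty,1)$ and $z,z'$, $\sum_xW_c(x,z|x',z')^{1-\theta}$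 does not depend on $x'$, or (ii) $|\mathcal Z|=1$. Either case implies that $W_{c,Z}(z|z'):=\sum_xW_c(x,z|x',z')$ is independent of $x'$. Perron–Frobenius notation: entrywise powers $a^t$ of transition probabilities are taken to be $0$ when $a=0$. For a nonnegative irreducible matrix $A$, $\lambda(A)$ is its Perron–Frobenius eigenvalue and $v_A$ the positive vector with $\sum_iv_A(i)A(i,j)=\lambda(A)v_A(j)$, normalized so $\min_iv_A(i)=1$. Quantities. $\theta H^{W_s}_{1-\theta}(M):=\log\lambda(A^s_\theta)$ with $A^s_\theta(m,m'):=W_s(m|m')^{1-\theta}$. For a transition matrix $V$ on $\mathcal Z$ with $V(z|z')>0$ whenever $W_{c,Z}(z|z')>0$, $H^{W_c|V}_{1-\theta}(X|Z):=\frac1\theta\log\lambda\big(W_c(x,z|x',z')^{1-\theta}V(z|z')^\theta\big)$, and $H^{W_c,\uparrow}_{1-\theta}(X|Z):=\max_VH^{W_c|V}_{1-\theta}(X|Z)$. For $r>0$: $U[W_s,W_c,\uparrow;r](\theta):=r\theta H^{W_s}_{1-\theta}(M)+\theta H^{W_c,\uparrow}_{1-\theta}(X|Z)$. $\overline\xi_{W_s}(\theta):=\log(v_{A^s_\theta}\cdot w^s_\theta)$ with $w^s_\theta(m):=P_{M_1}(m)^{1-\theta}$. If case (i) holds: $K_\theta(z,z'):=\big[\sum_xW_c(x,z|x',z')^{1-\theta}\big]^{\frac1{1-\theta}}$, $w^c_\theta(z):=\big[\sum_xP_{X_1Z_1}(x,z)^{1-\theta}\big]^{\frac1{1-\theta}}$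 and $\overline\xi_{W_c}(\theta):=\log(v_{K_\theta}\cdot w^c_\theta)$. Otherwise ($|\mathcal Z|=1$, $W_c$ viewed as $W_c(x|x')$ on $\mathcal X$): $\overline\xi_{W_c}(\theta):=\log(v_{B_\theta}\cdot w_\theta)$ with $B_\theta(x,x'):=W_c(x|x')^{1-\theta}$, $w_\theta(x):=P_{X_1}(x)^{1-\theta}$. *)

(* Defs.v *)
From HB Require Import structures.
From mathcomp Require Import all_boot all_algebra.
From Stdlib Require Import Reals ClassicalEpsilon.
Set Implicit Arguments. Unset Strict Implicit. Unset Printing Implicit Defensive.
Local Open Scope R_scope.

Notation Rsum T F := (\big[Rplus/R0]_(i : T) F i).
Notation Rprod T F := (\big[Rmult/R1]_(i : T) F i).

Definition pw (a t : R) : R := if Rlt_dec R0 a then Rpower a t else R0.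

(* Convention: W y x = W(y|x) (probability of moving from x to y). *)
Definition is_distr (T : finType) (P : T -> R) : Prop :=
  (forall x, 0 <= P x) /\ Rsum T P = 1.

Definition is_transition (T : finType) (W : T -> T -> R) : Prop :=
  forall x, (forall y, 0 <= W y x) /\ Rsum T (fun y => W y x) = 1.

Fixpoint mpow (T : finType) (W : T -> T -> R) (t : nat) : T -> T -> R :=
  match t with
  | O => fun y x => if y == x then R1 else R0
  | S t' => fun y x => Rsum T (fun u => W y u * mpow W t' u x)
  end.

Definition irreducible (T : finType) (W : T -> T -> R) : Prop :=
  forall x y : T, exists t : nat, 0 < mpow W t y x.

(* aperiodic: every state has period 1, i.e. the gcd of the return times
   {t >= 1 : W^t(x|x) > 0} is 1 (no d >= 2 divides all of them) *)
Definition aperiodic (T : finType) (W : T -> T -> R) : Prop :=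
  forall (x : T) (d : nat), leq 2 d ->
    exists t : nat, leq 1 t /\ 0 < mpow W t x x /\ ~~ dvdn d t.

Definition ordpred (L : nat) (i : 'I_L) : 'I_L :=
  Ordinal (leq_ltn_trans (leq_pred i) (ltn_ord i)).

Definition markov_law (T : finType) (P1 : T -> R) (W : T -> T -> R) (L : nat)
  (s : {ffun 'I_L -> T}) : R :=
  \big[Rmult/R1]_(i : 'I_L)
     (if eqn (nat_of_ord i) 0 then P1 (s i) else W (s i) (s (ordpred i))).

Definition zsub (X : zmodType) (a b : X) : X := GRing.add a (GRing.opp b).

(* noise (x^n - xt^n, z^n) realising output y = (x^n, z^n) on input xt^n *)
Definition noise_of (X : finZmodType) (Z : finType) (n : nat)
  (y : {ffun 'I_n -> X * Z}) (xt : {ffun 'I_n -> X}) : {ffun 'I_n -> X * Z} :=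
  [ffun i => (zsub (y i).1 (xt i), (y i).2)].

Definition err_prob (M : finType) (X : finZmodType) (Z : finType)
  (PM1 : M -> R) (Ws : M -> M -> R) (PXZ1 : X * Z -> R) (Wc : X * Z -> X * Z -> R)
  (k n : nat)
  (e : {ffun {ffun 'I_k -> M} -> {ffun 'I_n -> X}})
  (d : {ffun {ffun 'I_n -> X * Z} -> {ffun 'I_k -> M}}) : R :=
  Rsum {ffun 'I_k -> M} (fun m =>
    markov_law PM1 Ws m *
    Rsum {ffun 'I_n -> X * Z} (fun y =>
      if d y == m then R0 else markov_law PXZ1 Wc (noise_of y (e m)))).

Definition is_inf (A : R -> Prop) (r : R) : Prop :=
  (forall a, A a -> r <= a) /\ (forall r', (forall a, A a -> r' <= a) -> r' <= r).

Definition Pj (M : finType) (X : finZmodType) (Z : finType)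
  (PM1 : M -> R) (Ws : M -> M -> R) (PXZ1 : X * Z -> R) (Wc : X * Z -> X * Z -> R)
  (k n : nat) : R :=
  epsilon (inhabits R0) (is_inf (fun a => exists (e : {ffun {ffun 'I_k -> M} -> {ffun 'I_n -> X}})
      (d : {ffun {ffun 'I_n -> X * Z} -> {ffun 'I_k -> M}}), a = err_prob PM1 Ws PXZ1 Wc e d)).

Definition PF_spec (T : finType) (A : T -> T -> R) (p : R * (T -> R)) : Prop :=
  (forall i, 1 <= p.2 i) /\ (exists i, p.2 i = 1) /\
  (forall j, Rsum T (fun i => p.2 i * A i j) = p.1 * p.2 j).

Definition PF (T : finType) (A : T -> T -> R) : R * (T -> R) :=
  epsilon (inhabits (R0, fun _ : T => R0)) (PF_spec A).
Definition pf_eig (T : finType) (A : T -> T -> R) : R := (PF A).1.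
Definition pf_vec (T : finType) (A : T -> T -> R) : T -> R := (PF A).2.

Definition dot (T : finType) (v w : T -> R) : R := Rsum T (fun i => v i * w i).

Definition As_mat (M : finType) (Ws : M -> M -> R) (th : R) : M -> M -> R :=
  fun m m' => pw (Ws m m') (1 - th).

Definition thetaHs (M : finType) (Ws : M -> M -> R) (th : R) : R :=
  ln (pf_eig (As_mat Ws th)).

Definition Hcond (X : finZmodType) (Z : finType) (Wc : X * Z -> X * Z -> R)
  (V : Z -> Z -> R) (th : R) : R :=
  / th * ln (pf_eig (fun a b : X * Z => pw (Wc a b) (1 - th) * pw (V a.2 b.2) th)).

Definition admissibleV (X : finZmodType) (Z : finType) (Wc : X * Z -> X * Z -> R)
  (V : Z -> Z -> R) : Prop :=
  is_transition V /\
  forall (z z' : Z) (x' : X), 0 < Rsum X (fun x => Wc (x, z) (x', z')) -> 0 < V z z'.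

Definition is_sup (A : R -> Prop) (r : R) : Prop :=
  (forall a, A a -> a <= r) /\ (forall r', (forall a, A a -> a <= r') -> r <= r').

(* H^{W_c,up}_{1-theta}(X|Z) = max_V H^{W_c|V}_{1-theta}(X|Z) (as a supremum) *)
Definition Hup (X : finZmodType) (Z : finType) (Wc : X * Z -> X * Z -> R) (th : R) : R :=
  epsilon (inhabits R0)
    (is_sup (fun h => exists V, admissibleV Wc V /\ h = Hcond Wc V th)).

Definition Ufun (M : finType) (X : finZmodType) (Z : finType)
  (Ws : M -> M -> R) (Wc : X * Z -> X * Z -> R) (r th : R) : R :=
  r * thetaHs Ws th + th * Hup Wc th.

Definition xi_s (M : finType) (PM1 : M -> R) (Ws : M -> M -> R) (th : R) : R :=
  ln (dot (pf_vec (As_mat Ws th)) (fun m => pw (PM1 m) (1 - th))).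

Definition assumption2_i (X : finZmodType) (Z : finType) (Wc : X * Z -> X * Z -> R) : Prop :=
  forall (th : R), th < 1 -> forall (z z' : Z) (x1 x2 : X),
    Rsum X (fun x => pw (Wc (x, z) (x1, z')) (1 - th)) =
    Rsum X (fun x => pw (Wc (x, z) (x2, z')) (1 - th)).

Definition assumption2 (X : finZmodType) (Z : finType) (Wc : X * Z -> X * Z -> R) : Prop :=
  assumption2_i Wc \/ #|Z| = S O.

Definition K_mat (X : finZmodType) (Z : finType) (Wc : X * Z -> X * Z -> R) (th : R)
  : Z -> Z -> R :=
  fun z z' => pw (Rsum X (fun x => pw (Wc (x, z) (GRing.zero, z')) (1 - th))) (/ (1 - th)).

Definition xi_c (X : finZmodType) (Z : finType) (PXZ1 : X * Z -> R)
  (Wc : X * Z -> X * Z -> R) (th : R) : R :=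
  if excluded_middle_informative (assumption2_i Wc) then
    ln (dot (pf_vec (K_mat Wc th))
            (fun z => pw (Rsum X (fun x => pw (PXZ1 (x, z)) (1 - th))) (/ (1 - th))))
  else
    match [pick z : Z] with
    | Some z0 =>
        ln (dot (pf_vec (fun x x' : X => pw (Wc (x, z0) (x', z0)) (1 - th)))
                (fun x => pw (PXZ1 (x, z0)) (1 - th)))
    | None => R0
    end.

(* Main.v *)
Require Import Defs.
From HB Require Import structures.
From mathcomp Require Import all_boot all_algebra.
From Stdlib Require Import Reals ClassicalEpsilon Lra.
Set Implicit Arguments. Unset Strict Implicit. Unset Printing Implicit Defensive.
Local Open Scope R_scope.

(** Gallager's random coding bound with maximum a posteriori decoding, for a uniformly random
    encoder and [rho = s / (1 - s)], bounds the error probability by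
    [|X|^(- n s / (1 - s)) * (\sum_m P(m)^(1-s))^(1/(1-s)) *
     \sum_z (\sum_x P(x,z)^(1-s))^(1/(1-s))].
    For Markov sources both sums are controlled by the Perron-Frobenius eigenvector: since it is
    at least 1 everywhere, a path sum is at most its pairing with the eigenvector at the final
    state, which equals [lambda^(L-1) * (v . w)].  In case (i) the eigenvalue [lambda] of [K_s] is
    related to the conditional entropy by the transition matrix
    [V(z|z') = v(z) K_s(z,z') / (lambda v(z'))], for which the tilted channel matrix has
    eigenvalue [lambda^(1-s)]. *)

(** * Finite sums and truncated powers *)

(** These laws register [Rplus] and [Rmult] with the big-operator library, so that its
    distributivity and exchange lemmas apply to [Rsum] and [Rprod]. *)
Fact RplusA : associative Rplus. Proof. by move=> x y z; rewrite Rplus_assoc. Qed.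
Fact RmultA : associative Rmult. Proof. by move=> x y z; rewrite Rmult_assoc. Qed.
Fact Rmult0l : left_zero R0 Rmult. Proof. exact: Rmult_0_l. Qed.
Fact Rmult0r : right_zero R0 Rmult. Proof. exact: Rmult_0_r. Qed.
Fact RmultDl : left_distributive Rmult Rplus. Proof. by move=> x y z; ring. Qed.
Fact RmultDr : right_distributive Rmult Rplus. Proof. by move=> x y z; ring. Qed.
HB.instance Definition _ := Monoid.isComLaw.Build R R0 Rplus RplusA Rplus_comm Rplus_0_l.
HB.instance Definition _ := Monoid.isComLaw.Build R R1 Rmult RmultA Rmult_comm Rmult_1_l.
HB.instance Definition _ := Monoid.isMulLaw.Build R R0 Rmult Rmult0l Rmult0r.
HB.instance Definition _ := Monoid.isAddLaw.Build R Rmult Rplus RmultDl RmultDr.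

Section FiniteSums.
Variable T : finType.
Implicit Types F G : T -> R.

Lemma Rsum_le F G : (forall i, F i <= G i) -> Rsum T F <= Rsum T G.
Proof.
move=> le_FG; apply: (big_ind2 (fun x y => x <= y)) => //; first exact: Rle_refl.
by move=> *; apply: Rplus_le_compat.
Qed.

Lemma Rsum_ge0 F : (forall i, 0 <= F i) -> 0 <= Rsum T F.
Proof.
move=> F0; apply: (big_ind (fun x => 0 <= x)) => //; first exact: Rle_refl.
by move=> *; apply: Rplus_le_le_0_compat.
Qed.

Lemma Rsum_mull (a : R) F : a * Rsum T F = Rsum T (fun i => a * F i).
Proof. by rewrite big_distrr. Qed.

Lemma Rsum_mulr (a : R) F : Rsum T F * a = Rsum T (fun i => F i * a).
Proof. by rewrite big_distrl. Qed.

Lemma Rsum_const (a : R) : Rsum T (fun=> a) = INR #|T| * a.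
Proof.
rewrite big_const; elim: #|T| => [|n IH]; first by rewrite /= Rmult_0_l.
by rewrite iterS IH S_INR; ring.
Qed.

Lemma Rsum_ge_term F j : (forall i, 0 <= F i) -> F j <= Rsum T F.
Proof.
move=> F0; rewrite (bigD1 j) //=.
suff : 0 <= \big[Rplus/R0]_(i | i != j) F i by lra.
by apply: (big_ind (fun x => 0 <= x)) => // *; lra.
Qed.

Lemma Rsum_gt0_ex F : 0 < Rsum T F -> exists i, 0 < F i.
Proof.
move=> F_gt0; apply: NNPP => nF; suff : Rsum T F <= 0 by lra.
have -> : 0 = Rsum T (fun=> R0) by rewrite big1.
by apply: Rsum_le => i; apply: Rnot_lt_le => Fi; apply: nF; exists i.
Qed.

Lemma Rargmax (x0 : T) F : exists x, forall y, F y <= F x.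
Proof.
suff [x _ xP] : exists2 x, x \in x0 :: enum T & forall y, y \in x0 :: enum T -> F y <= F x.
  by exists x => y; apply: xP; rewrite inE mem_enum orbT.
elim: (enum T) => [|a s [x xs xP]].
  by exists x0; rewrite ?mem_head // => y; rewrite inE => /eqP->; apply: Rle_refl.
case: (Rle_dec (F a) (F x)) => Fax.
  exists x => [|y]; first by move: xs; rewrite !inE => /orP[->|->]; rewrite ?orbT.
  rewrite !inE => /or3P[yx|/eqP->//|ys]; apply: xP; rewrite inE ?yx ?ys ?orbT //.
exists a => [|y]; first by rewrite !inE eqxx orbT.
rewrite !inE => /or3P[yx|/eqP->|ys]; try lra.
  by apply: Rle_trans (xP y _) _; [rewrite inE yx|lra].
by apply: Rle_trans (xP y _) _; [rewrite inE ys orbT|lra].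
Qed.

Lemma Rargmin (x0 : T) F : exists x, forall y, F x <= F y.
Proof.
by have [x xP] := Rargmax x0 (fun y => - F y); exists x => y; move: (xP y); lra.
Qed.

End FiniteSums.

Lemma Rprod_ge0 (T : finType) (F : T -> R) : (forall i, 0 <= F i) -> 0 <= Rprod T F.
Proof.
by move=> F0; apply: (big_ind (fun x => 0 <= x)) => // *; [lra|apply: Rmult_le_pos].
Qed.

Section TruncatedPower.
Implicit Types a b p q t : R.

Lemma pwE a t : 0 < a -> pw a t = Rpower a t.
Proof. by rewrite /pw; case: Rlt_dec. Qed.

Lemma pw0 a t : a <= 0 -> pw a t = 0.
Proof. by rewrite /pw; case: Rlt_dec => // *; lra. Qed.

Lemma pw_gt0 a t : 0 < a -> 0 < pw a t.
Proof. by move=> a0; rewrite pwE //; apply: exp_pos. Qed.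

Lemma pw_ge0 a t : 0 <= pw a t.
Proof.
by case: (Rlt_dec 0 a) => a0; [apply/Rlt_le/pw_gt0|rewrite pw0; lra].
Qed.

Lemma pwM a b t : 0 <= a -> 0 <= b -> pw (a * b) t = pw a t * pw b t.
Proof.
move=> [a0|<-] [b0|<-]; rewrite ?Rmult_0_l ?Rmult_0_r ?[pw 0 _]pw0 ?Rmult_0_l ?Rmult_0_r //; try lra.
by rewrite !pwE ?Rpower_mult_distr //; apply: Rmult_lt_0_compat.
Qed.

Lemma pwD a p q : pw a (p + q) = pw a p * pw a q.
Proof.
case: (Rlt_dec 0 a) => a0; first by rewrite !pwE // Rpower_plus.
by rewrite !pw0; lra.
Qed.

Lemma pw_pw a p q : pw (pw a p) q = pw a (p * q).
Proof.
case: (Rlt_dec 0 a) => a0; first by rewrite (pwE _ (pw_gt0 p a0)) !pwE // Rpower_mult.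
by rewrite !(@pw0 a) ?[pw 0 _]pw0; lra.
Qed.

Lemma pw1 a : 0 <= a -> pw a 1 = a.
Proof. by move=> [a0|<-]; [rewrite pwE ?Rpower_1|rewrite pw0; lra]. Qed.

Lemma pw1l t : pw 1 t = 1.
Proof. by rewrite pwE /Rpower ?ln_1 ?Rmult_0_r ?exp_0 //; lra. Qed.

Lemma pwK a p : 0 <= a -> p <> 0 -> pw (pw a p) (/ p) = a.
Proof. by move=> a0 p0; rewrite pw_pw Rinv_r // pw1. Qed.

Lemma pw_le a b t : 0 <= t -> a <= b -> pw a t <= pw b t.
Proof.
move=> t0 ab; case: (Rlt_dec 0 a) => a0; last by rewrite (pw0 t (a := a)); [apply: pw_ge0|lra].
by rewrite !pwE; try lra; apply: Rle_Rpower_l; lra.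
Qed.

Lemma pw_le1 a t : 0 <= t -> a <= 1 -> pw a t <= 1.
Proof. by move=> t0 a1; rewrite -(pw1l t); apply: pw_le. Qed.

Lemma pw_ge_id a p : 0 <= p <= 1 -> 0 <= a <= 1 -> a <= pw a p.
Proof.
move=> p01 a01; rewrite -{1}(pw1 (a := a)); last lra.
have -> : 1 = p + (1 - p) by ring.
rewrite pwD -{2}[pw a p]Rmult_1_r.
by apply: Rmult_le_compat_l; [apply: pw_ge0|apply: pw_le1; lra].
Qed.

Lemma ln_pw a t : 0 < a -> ln (pw a t) = t * ln a.
Proof. by move=> a0; rewrite pwE // ln_exp. Qed.

Lemma pw_prod (T : finType) (F : T -> R) t :
  (forall i, 0 <= F i) -> pw (Rprod T F) t = Rprod T (fun i => pw (F i) t).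
Proof.
move=> F0; suff [] : 0 <= Rprod T F /\ pw (Rprod T F) t = Rprod T (fun i => pw (F i) t) by [].
apply: (big_ind2 (fun x y => 0 <= x /\ pw x t = y)) => //.
- by rewrite pw1l; split=> //; lra.
- by move=> ? ? ? ? [x0 <-] [y0 <-]; split; [apply: Rmult_le_pos|rewrite pwM].
Qed.

(* Tangent-line form of concavity: it replaces Jensen's inequality in the random coding argument. *)
Lemma pw_tangent a c r :
  0 <= r <= 1 -> 0 <= a -> 0 < c -> pw a r <= pw c r * (1 - r + r * (a / c)).
Proof.
move=> r01 a0 c0; pose u := a / c.
have u0 : 0 <= u by apply: Rle_mult_inv_pos.
have -> : a = c * u by rewrite /u; field; lra.
rewrite pwM //; last lra.
rewrite (_ : c * u / c = u); last by field; lra.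
apply: Rmult_le_compat_l; first exact: pw_ge0.
case: u0 => [u0|<-]; last by rewrite pw0; lra.
rewrite pwE // /Rpower; set y := ln u.
have -> : u = exp y by rewrite exp_ln.
set e := exp (r * y).
have e0 : 0 < e by apply: exp_pos.
(* Both inequalities come from [exp t >= 1 + t], at [- r y] and at [(1 - r) y]; with weights [1 - r]
   and [r] the terms in [y] cancel. *)
have h1 : e * (1 - r * y) <= 1.
  have {2}<- : e * exp (- (r * y)) = 1 by rewrite -exp_plus Rplus_opp_r exp_0.
  by apply: Rmult_le_compat_l; [lra | have := exp_ineq1_le (- (r * y)); lra].
have h2 : e * (1 + (1 - r) * y) <= exp y.
  rewrite {2}(_ : y = r * y + (1 - r) * y); last ring.
  rewrite exp_plus; apply: Rmult_le_compat_l; [lra | exact: exp_ineq1_le].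
have := Rmult_le_compat_l (1 - r) _ _ _ h1; have := Rmult_le_compat_l r _ _ _ h2.
by lra.
Qed.

(** After division by the total the entries lie in [0, 1], where [a <= a ^ p]. In case (i) this
    gives the initial vector mass at least 1. *)
Lemma Rsum_le_pw_sum (T : finType) (F : T -> R) p :
  0 < p <= 1 -> (forall i, 0 <= F i) ->
  Rsum T F <= pw (Rsum T (fun i => pw (F i) p)) (/ p).
Proof.
move=> p01 F0; set t := Rsum T F.
have t0 : 0 <= t by apply: Rsum_ge0.
case: t0 => [t0|<-]; last exact: pw_ge0.
have ip : 0 <= / p by apply/Rlt_le/Rinv_0_lt_compat; lra.
rewrite -{1}(@pwK t p); try lra.
apply: pw_le => //.
have -> : pw t p = Rsum T (fun i => pw t p * (F i / t)).
  by rewrite -Rsum_mull -Rsum_mulr -/t; field; lra.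
apply: Rsum_le => i.
have Fit : 0 <= F i / t by apply: Rle_mult_inv_pos.
rewrite {2}(_ : F i = t * (F i / t)); last by field; lra.
rewrite pwM //; last lra.
apply: Rmult_le_compat_l; first exact: pw_ge0.
apply: pw_ge_id; first lra; split=> //.
apply: (Rmult_le_reg_r t) => //.
rewrite (_ : F i / t * t = F i) ?Rmult_1_l; first exact: Rsum_ge_term.
by field; lra.
Qed.

End TruncatedPower.

(** * Existence and uniqueness of Perron-Frobenius pairs *)

Lemma is_sup_ex (E : R -> Prop) (b : R) :
  (exists a, E a) -> (forall a, E a -> a <= b) -> exists r, is_sup E r.
Proof.
move=> exE ubE; have [m [m1 m2]] := completeness E (ex_intro _ b ubE) exE.
by exists m; split.
Qed.

Lemma is_inf_ex (E : R -> Prop) (b : R) :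
  (exists a, E a) -> (forall a, E a -> b <= a) -> exists r, is_inf E r.
Proof.
move=> [a Ea] lbE.
have [||m [m1 m2]] := @is_sup_ex (fun x => E (- x)) (- b).
- by exists (- a); rewrite Ropp_involutive.
- by move=> x /lbE; lra.
exists (- m); split=> [x Ex|r' lb'].
  by have := m1 (- x); rewrite Ropp_involutive => /(_ Ex); lra.
suff : m <= - r' by lra.
by apply: m2 => x /lb'; lra.
Qed.

Lemma fun_choice (S U : Type) (Q : S -> U -> Prop) :
  (forall x, exists y, Q x y) -> exists f, forall x, Q x (f x).
Proof.
move=> exQ; exists (fun x => proj1_sig (constructive_indefinite_description _ (exQ x))).
by move=> x; apply: proj2_sig.
Qed.

Section PerronFrobenius.
Variables (T : finType) (A : T -> T -> R).
Hypothesis A_ge0 : forall i j, 0 <= A i j.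

Definition lmul (v : T -> R) : T -> R := fun j => Rsum T (fun i => v i * A i j).

Lemma mpow_ge0 t i j : 0 <= mpow A t i j.
Proof.
elim: t i j => [|t IH] i j /=; first by case: eqP; lra.
by apply: Rsum_ge0 => u; apply: Rmult_le_pos.
Qed.

Lemma lmul_ge0 v j : (forall i, 0 <= v i) -> 0 <= lmul v j.
Proof. by move=> v0; apply: Rsum_ge0 => i; apply: Rmult_le_pos. Qed.

Lemma lmul_le u v j : (forall i, u i <= v i) -> lmul u j <= lmul v j.
Proof. by move=> uv; apply: Rsum_le => i; apply: Rmult_le_compat_r. Qed.

Lemma lmulZ c v j : lmul (fun i => c * v i) j = c * lmul v j.
Proof. by rewrite /lmul Rsum_mull; apply: eq_bigr => i _; ring. Qed.

Lemma iter_lmul t v j : iter t lmul v j = Rsum T (fun i => v i * mpow A t i j).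
Proof.
elim: t v j => [|t IH] v j /=.
  rewrite (bigD1 j) //= eqxx big1 => [|i /negPf->]; last by rewrite Rmult_0_r.
  by rewrite Rmult_1_r Rplus_0_r.
rewrite -iterS iterSr IH /lmul.
under eq_bigr => i _ do rewrite Rsum_mulr.
rewrite exchange_big; apply: eq_bigr => i _ /=.
by rewrite Rsum_mull; apply: eq_bigr => u _; ring.
Qed.

Lemma iter_lmul_ge_term t v i j :
  (forall i, 0 <= v i) -> v i * mpow A t i j <= iter t lmul v j.
Proof.
move=> v0; rewrite iter_lmul; apply: (@Rsum_ge_term _ (fun i => v i * mpow A t i j)) => l.
by apply: Rmult_le_pos => //; apply: mpow_ge0.
Qed.

Lemma iter_lmul_le c t v : 0 <= c ->
  (forall j, lmul v j <= c * v j) -> forall j, iter t lmul v j <= c ^ t * v j.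
Proof.
move=> c0 vc; elim: t => [|t IH] j /=; first by lra.
apply: Rle_trans (lmul_le j IH) _; rewrite lmulZ.
have := Rmult_le_compat_l _ _ _ (pow_le c t c0) (vc j); lra.
Qed.

Hypothesis A_irr : irreducible A.
Variable j0 : T.

(** The least [t] admitting such a vector is the Perron-Frobenius eigenvalue, as in the
    Collatz-Wielandt formula. The condition at [j0] excludes the zero vector and, being an
    inequality, survives the addition of iterates. *)
Definition subeigen (t : R) (v : T -> R) : Prop :=
  (forall i, 0 <= v i) /\ 1 <= v j0 /\ (forall j, lmul v j <= t * v j).

Lemma subeigen_ge0 t v : subeigen t v -> 0 <= t.
Proof.
case=> v0 [v1 vt]; have := vt j0; have := lmul_ge0 j0 v0 => h1 h2.
apply: Rnot_lt_le => t0; have := Rmult_lt_0_compat (- t) (v j0); lra.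
Qed.

Lemma subeigen_le t t' v : t <= t' -> subeigen t v -> subeigen t' v.
Proof.
move=> tt' [v0 [v1 vt]]; split=> //; split=> // j; apply: Rle_trans (vt j) _.
exact: Rmult_le_compat_r.
Qed.

Lemma subeigen_ex : exists t v, subeigen t v.
Proof.
exists (Rsum T (fun j => Rsum T (fun i => A i j))), (fun=> 1).
split=> [_|]; first lra; split=> [|j]; first lra.
rewrite Rmult_1_r /lmul; under eq_bigr => i _ do rewrite Rmult_1_l.
apply: (@Rsum_ge_term _ (fun j => Rsum T (fun i => A i j))) => l.
exact: Rsum_ge0.
Qed.

(* Subeigenvectors are closed under pointwise infima, so no compactness argument is needed. *)
Lemma subeigen_least t : 0 < t -> (exists v, subeigen t v) ->
  exists u, subeigen t u /\ forall v, subeigen t v -> forall i, u i <= v i.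
Proof.
move=> t0 [v tv].
have /fun_choice [u uP] : forall i, exists r, is_inf (fun a => exists v, subeigen t v /\ a = v i) r.
  move=> i; apply: (@is_inf_ex _ 0); first by exists (v i), v.
  by move=> _ [w [[w0 _] ->]].
have ule w : subeigen t w -> forall i, u i <= w i.
  by move=> tw i; apply: (uP i).1; exists w.
exists u; split=> //; split; last split.
- by move=> i; apply: (uP i).2 => _ [w [[w0 _] ->]].
- by apply: (uP j0).2 => _ [w [[_ [w1 _]] ->]].
(* Dividing by [t > 0] turns the claim into a lower bound for the infimum [u j]. *)
move=> j; suff : / t * lmul u j <= u j.
  move=> /(Rmult_le_compat_l t _ _ (Rlt_le _ _ t0)).
  by rewrite -Rmult_assoc Rinv_r ?Rmult_1_l //; lra.
apply: (uP j).2 => _ [w [tw ->]]; apply: (Rmult_le_reg_l t) => //.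
rewrite -Rmult_assoc Rinv_r ?Rmult_1_l; last lra.
by apply: Rle_trans (lmul_le j (ule w tw)) _; apply: tw.2.2.
Qed.

(** If [u j0] exceeded 1, dividing by it would give a subeigenvector below the least one. *)
Lemma subeigen_least_norm t u : subeigen t u ->
  (forall v, subeigen t v -> forall i, u i <= v i) -> u j0 = 1.
Proof.
move=> [u0 [u1 ut]] umin; apply: Rle_antisym => //.
have -> : 1 = / u j0 * u j0 by field; lra.
have iu : 0 <= / u j0 by apply/Rlt_le/Rinv_0_lt_compat; lra.
apply: (umin (fun i => / u j0 * u i)); split=> [i|]; first exact: Rmult_le_pos.
split=> [|j]; first by rewrite Rinv_l; lra.
rewrite lmulZ (_ : t * _ = / u j0 * (t * u j)); last ring.
exact: Rmult_le_compat_l.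
Qed.

(** By irreducibility some [A^k (i, j0)] is positive, and [v i * A^k (i, j0) <= (v A^k) j0 <= c^k].
    Uniformity in [v] is what makes monotone sequences of subeigenvectors converge. *)
Lemma subeigen_bound c : 0 <= c ->
  exists C : T -> R, forall v, subeigen c v -> v j0 = 1 -> forall i, v i <= C i.
Proof.
move=> c0; have /fun_choice [k kP] : forall i, exists k, 0 < mpow A k i j0 by move=> i; apply: A_irr.
exists (fun i => / mpow A (k i) i j0 * c ^ k i) => v [v0 [_ vc]] v1 i.
apply: (Rmult_le_reg_l (mpow A (k i) i j0)) => //.
rewrite -Rmult_assoc Rinv_r ?Rmult_1_l; last by have := kP i; lra.
rewrite Rmult_comm; apply: Rle_trans (iter_lmul_ge_term (k i) i j0 v0) _.
by apply: Rle_trans (iter_lmul_le (k i) c0 vc j0) _; rewrite v1; lra.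
Qed.

Lemma Un_cv_Rsum (F : nat -> T -> R) (l : T -> R) :
  (forall i, Un_cv (fun n => F n i) (l i)) -> Un_cv (fun n => Rsum T (F n)) (Rsum T l).
Proof.
move=> Fl; rewrite unlock /reducebig; elim: (index_enum T) => [|a s IH] /=.
  by move=> e e0; exists O => n _; rewrite /R_dist Rminus_diag Rabs_R0.
exact: (CV_plus _ _ _ _ (Fl a) IH).
Qed.

(** Let [t n] decrease to the infimum [lam] of the admissible values. A smaller [t] leaves fewer
    subeigenvectors, so the least ones increase with [n]; being bounded, they converge, and the
    limit is a subeigenvector for [lam]. *)
Lemma subeigen_min : exists lam v, subeigen lam v /\
  forall t w, subeigen t w -> lam <= t.
Proof.
have [t0 [v0 tv0]] := subeigen_ex.
have [||lam [lam1 lam2]] := @is_inf_ex (fun t => exists v, subeigen t v) 0.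
- by exists t0, v0.
- by move=> t [v]; apply: subeigen_ge0.
have lam_ge0 : 0 <= lam by apply: lam2 => t [v]; apply: subeigen_ge0.
pose t n := lam + pos (RinvN n).
have tgt n : lam < t n by rewrite /t; have := cond_pos (RinvN n); lra.
have /fun_choice [u uP] : forall n, exists u, subeigen (t n) u /\
    forall v, subeigen (t n) v -> forall i, u i <= v i.
  move=> n; apply: subeigen_least; first by have := tgt n; lra.
  (* Otherwise monotonicity in [t] would make [t n > lam] a lower bound of all admissible values. *)
  apply: NNPP => nS; suff : t n <= lam by have := tgt n; lra.
  apply: lam2 => r [v rv]; apply: Rnot_lt_le => rt; apply: nS; exists v.
  by apply: subeigen_le rv; lra.
have tle n m : (n <= m)%coq_nat -> t m <= t n.
  move=> nm; rewrite /t /=; apply/Rplus_le_compat_l/Rinv_le_contravar.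
    by have := pos_INR n; lra.
  by have := le_INR _ _ nm; lra.
have u1 n : u n j0 = 1 by apply: subeigen_least_norm (uP n).1 (uP n).2.
have t0_ge0 : 0 <= t O by have := tgt O; lra.
have [C CP] := subeigen_bound t0_ge0.
have /fun_choice [v vP] : forall i, exists l, Un_cv (fun n => u n i) l.
  move=> i; have [||l lP] := growing_cv (fun n => u n i); last by exists l.
    move=> n; apply: (uP n).2; apply: subeigen_le (uP n.+1).1.
    by apply: tle; apply: Nat.le_succ_diag_r.
  exists (C i) => _ [n ->]; apply: CP => //; apply: subeigen_le (uP n).1.
  by apply: tle; apply: Nat.le_0_l.
have cst c : Un_cv (fun=> c) c.
  by move=> e e0; exists O => n _; rewrite /R_dist Rminus_diag Rabs_R0.
have tcv : Un_cv t lam.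
  by have := CV_plus _ _ _ _ (cst lam) RinvN_cv; rewrite Rplus_0_r.
exists lam, v; split; last by move=> r w rw; apply: lam1; exists w.
split=> [i|]; last split.
- by apply: (@Rle_cv_lim (fun=> 0) (fun n => u n i) _ _) => // n; apply: (uP n).1.1.
- by apply: (@Rle_cv_lim (fun=> 1) (fun n => u n j0) _ _) => // n; apply: (uP n).1.2.1.
move=> j; apply: (@Rle_cv_lim (fun n => lmul (u n) j) (fun n => t n * u n j) _ _).
- by move=> n; apply: (uP n).1.2.2.
- by apply: Un_cv_Rsum => i; apply: (CV_mult _ _ _ _ (vP i) (cst _)).
- exact: CV_mult.
Qed.

(* If v were a strict subeigenvector, the powers of A would spread the slack to all coordinates. *)
Lemma subeigen_min_eigen lam v : subeigen lam v ->
  (forall t w, subeigen t w -> lam <= t) -> forall j, lmul v j = lam * v j.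
Proof.
move=> [v0 [v1 vlam]] lam_min; pose w j := lam * v j - lmul v j.
have w0 j : 0 <= w j by rewrite /w; have := vlam j; lra.
suff wle i : w i <= 0 by move=> j; have := w0 j; have := wle j; rewrite /w; lra.
apply: Rnot_lt_le => wi.
have /fun_choice [k kP] : forall j, exists k, 0 < mpow A k i j by move=> j; apply: A_irr.
(* Summing iterates up to [N] turns the slack [w] of [v] into the slack [w' = lam v' - v' A] of
   [v'], to each coordinate of which [w i] contributes a positive amount. *)
pose N := \max_j k j.
pose v' j := Rsum 'I_N.+1 (fun m => iter m lmul v j).
pose w' j := Rsum 'I_N.+1 (fun m => iter m lmul w j).
have it0 u m j : (forall i, 0 <= u i) -> 0 <= iter m lmul u j.
  by move=> u0; elim: m j => //= m IH j; apply: lmul_ge0.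
have itw m j : iter m lmul w j = lam * iter m lmul v j - iter m.+1 lmul v j.
  rewrite iterSr !iter_lmul Rsum_mull /Rminus -[- _]Rmult_1_l Ropp_mult_distr_r_reverse.
  rewrite -Ropp_mult_distr_l_reverse Rsum_mull -big_split.
  by apply: eq_bigr => l _ /=; rewrite /w; ring.
have w'E j : w' j = lam * v' j - lmul v' j.
  have -> : lmul v' j = Rsum 'I_N.+1 (fun m => iter m.+1 lmul v j).
    rewrite /lmul; under eq_bigr => l _ do rewrite Rsum_mulr.
    by rewrite exchange_big.
  rewrite /w' Rsum_mull /Rminus -[- _]Rmult_1_l Ropp_mult_distr_r_reverse.
  rewrite -Ropp_mult_distr_l_reverse Rsum_mull -big_split.
  by apply: eq_bigr => l _ /=; rewrite itw /=; ring.
have w'pos j : 0 < w' j.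
  have kN : leq (k j).+1 N.+1 by rewrite ltnS; apply: leq_bigmax.
  have := @Rsum_ge_term _ (fun m : 'I_N.+1 => iter m lmul w j) (Ordinal kN) (fun m => it0 w m j w0).
  have := iter_lmul_ge_term (k j) i j w0.
  by have := Rmult_lt_0_compat _ _ wi (kP j); rewrite /w' /=; lra.
have v'0 j : 0 <= v' j by apply: Rsum_ge0 => m; apply: it0.
have v'1 : 1 <= v' j0.
  have := @Rsum_ge_term _ (fun m : 'I_N.+1 => iter m lmul v j0) ord0 (fun m => it0 v m j0 v0).
  by rewrite /v' /=; lra.
have [a aP] := Rargmin j0 w'; have [b bP] := Rargmax j0 v'.
have vb : 0 < v' b by have := bP j0; lra.
have eps : 0 < w' a / v' b by apply: Rdiv_lt_0_compat.
(* Lowering [lam] by the smallest slack over the largest entry keeps [v'] a subeigenvector, against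
   minimality. *)
suff /lam_min : subeigen (lam - w' a / v' b) v' by lra.
split=> //; split=> // j.
have : w' a / v' b * v' j <= w' j.
  apply: Rle_trans (aP j); rewrite -[X in _ <= X]Rmult_1_r.
  apply: Rle_trans (_ : w' a / v' b * v' b <= _); last by apply: Req_le; field; lra.
  by apply: Rmult_le_compat_l; [lra|exact: bP].
by rewrite (w'E j); lra.
Qed.

Lemma PF_ex : exists p, PF_spec A p.
Proof.
have [lam [v [lv lam_min]]] := subeigen_min.
have veig := subeigen_min_eigen lv lam_min.
have lam0 := subeigen_ge0 lv; have [v0 [v1 _]] := lv.
(* Some [A^k (j0, j)] is positive, and [v j0 * A^k (j0, j) <= lam^k * v j] excludes [v j = 0]. *)
have vpos j : 0 < v j.
  have [k kP] := A_irr j j0.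
  have := iter_lmul_ge_term k j0 j v0.
  have := iter_lmul_le k lam0 (fun j => Req_le _ _ (veig j)) j.
  have := Rmult_lt_0_compat (v j0) _ (Rlt_le_trans _ _ _ Rlt_0_1 v1) kP.
  by case: (v0 j) => // <-; lra.
have [a aP] := Rargmin j0 v.
exists (lam, fun i => / v a * v i); split=> /= [i|]; last split.
- apply: (Rmult_le_reg_l (v a)) => //; rewrite -Rmult_assoc Rinv_r; last by have := vpos a; lra.
  by have := aP i; lra.
- by exists a; rewrite Rinv_l //; have := vpos a; lra.
by move=> j; rewrite -/(lmul (fun i => / v a * v i) j) lmulZ veig; ring.
Qed.

(** Existence makes the [epsilon] in [PF] return a genuine Perron-Frobenius pair rather than an
    arbitrary value. *)
Lemma PFP : PF_spec A (PF A).
Proof. exact: epsilon_spec PF_ex. Qed.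

End PerronFrobenius.

(* Evaluate the eigen-equation where the ratio of the two eigenvectors is largest. *)
Lemma eigenvalue_le (T : finType) (A : T -> T -> R) (j0 : T) (v w : T -> R) (a b : R) :
  (forall i j, 0 <= A i j) -> (forall i, 0 < v i) -> (forall i, 0 < w i) ->
  (forall j, lmul A v j = a * v j) -> (forall j, lmul A w j = b * w j) -> b <= a.
Proof.
move=> A0 v0 w0 va wb; have [j jP] := Rargmax j0 (fun i => w i / v i).
have wle i : w i <= w j / v j * v i.
  have -> : w i = w i / v i * v i by field; have := v0 i; lra.
  by apply: Rmult_le_compat_r; [apply: Rlt_le|exact: jP].
have := lmul_le A0 j wle; rewrite lmulZ va wb => h.
apply: (Rmult_le_reg_r (w j)) => //; apply: Rle_trans h _.
by apply: Req_le; field; have := v0 j; lra.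
Qed.

(** Comparison with the chosen eigenvector in both directions; any positive left eigenvector thus
    identifies [pf_eig]. *)
Lemma eigenvalue_uniq (T : finType) (A : T -> T -> R) (j0 : T) (v : T -> R) (a : R) :
  (forall i j, 0 <= A i j) -> irreducible A -> (forall i, 0 < v i) ->
  (forall j, Rsum T (fun i => v i * A i j) = a * v j) -> pf_eig A = a.
Proof.
move=> A0 Airr v0 va; have [p1 [_ peig]] := PFP A0 Airr j0.
have p0 i : 0 < (PF A).2 i by have := p1 i; lra.
by apply: Rle_antisym; [apply: (eigenvalue_le j0 A0 v0 p0) | apply: (eigenvalue_le j0 A0 p0 v0)].
Qed.

(** * Random coding *)

Section RandomFunction.
Variables (A B : finType) (q : B -> R).
Hypothesis q_sum1 : Rsum B q = 1.

(** Expectation over a random encoder whose codewords are independent with law [q]. *)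
Definition expect (f : {ffun A -> B} -> R) : R :=
  Rsum {ffun A -> B} (fun e : {ffun A -> B} => Rprod A (fun i => q (e i)) * f e).

Lemma expect_prod (F : A -> B -> R) :
  expect (fun e => Rprod A (fun i => F i (e i))) =
  Rprod A (fun i => Rsum B (fun b => q b * F i b)).
Proof. by rewrite bigA_distr_bigA; apply: eq_bigr => e _; rewrite -big_split. Qed.

Lemma expect_eq f g : f =1 g -> expect f = expect g.
Proof. by move=> fg; apply: eq_bigr => e _; rewrite fg. Qed.

Lemma expect_const c : expect (fun=> c) = c.
Proof.
rewrite /expect -Rsum_mulr -[RHS]Rmult_1_l; congr (_ * _).
rewrite -(bigA_distr_bigA (fun _ : A => q)).
by rewrite big1.
Qed.

Lemma expect1 m (f : B -> R) : expect (fun e => f (e m)) = Rsum B (fun b => q b * f b).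
Proof.
(* A function of one codeword is a product over all codewords, with factor 1 elsewhere. *)
pose F i b := if i == m then f b else 1.
rewrite (@expect_eq _ (fun e => Rprod A (fun i => F i (e i)))) => [|e].
  rewrite expect_prod (bigD1 m) //= [X in _ * X]big1 => [|i /negPf im]; rewrite /F.
    by rewrite eqxx Rmult_1_r.
  by rewrite im; apply: etrans q_sum1; apply: eq_bigr => b _; rewrite Rmult_1_r.
by rewrite (bigD1 m) //= big1 => [|i /negPf im]; rewrite /F ?eqxx ?im ?Rmult_1_r.
Qed.

(** Pairwise independence of distinct codewords, on which the averaging over competing messages
    rests. *)
Lemma expect2 m m' (f g : B -> R) : m' != m ->
  expect (fun e => f (e m) * g (e m')) =
  Rsum B (fun b => q b * f b) * Rsum B (fun b => q b * g b).
Proof.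
move=> m'm; pose F i b := if i == m then f b else if i == m' then g b else 1.
rewrite (@expect_eq _ (fun e => Rprod A (fun i => F i (e i)))) => [|e].
  rewrite expect_prod (bigD1 m) //= (bigD1 m') //= [X in _ * (_ * X)]big1 => [|i /andP[/negPf im /negPf im']].
    by rewrite /F eqxx (negPf m'm) eqxx Rmult_1_r.
  by rewrite /F im im'; apply: etrans q_sum1; apply: eq_bigr => b _; rewrite Rmult_1_r.
rewrite (bigD1 m) //= (bigD1 m') //= big1 => [|i /andP[/negPf im /negPf im']].
  by rewrite /F eqxx (negPf m'm) eqxx Rmult_1_r.
by rewrite /F im im'.
Qed.

Lemma expect_sum (I : finType) (Q : pred I) (F : I -> {ffun A -> B} -> R) :
  expect (fun e => \big[Rplus/R0]_(i | Q i) F i e) = \big[Rplus/R0]_(i | Q i) expect (F i).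
Proof. by rewrite /expect exchange_big; apply: eq_bigr => e _; rewrite big_distrr. Qed.

Lemma expectZ c f : expect (fun e => c * f e) = c * expect f.
Proof. by rewrite /expect Rsum_mull; apply: eq_bigr => e _; ring. Qed.

Lemma expectD f g : expect (fun e => f e + g e) = expect f + expect g.
Proof. by rewrite /expect -big_split; apply: eq_bigr => e _ /=; ring. Qed.

Hypothesis q_ge0 : forall b, 0 <= q b.

Lemma expect_le f g : (forall e, f e <= g e) -> expect f <= expect g.
Proof.
move=> fg; apply: Rsum_le => e; apply: Rmult_le_compat_l => //.
exact: Rprod_ge0.
Qed.

(** Probabilistic method: a minimising encoder does at least as well as the average. *)
Lemma expect_attained f : exists e, f e <= expect f.
Proof.
have [b _] : exists b, 0 < q b by apply: Rsum_gt0_ex; rewrite q_sum1; lra.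
have [e eP] := Rargmin [ffun=> b] f; exists e.
by rewrite -[X in X <= _]expect_const; apply: expect_le.
Qed.

End RandomFunction.

Section RandomCoding.
Variables (A B Y : finType) (P : A -> R) (W : B -> Y -> R) (q : B -> R) (s : R).
Hypotheses (s_bounds : 0 < s <= / 2) (P_ge0 : forall m, 0 <= P m).
Hypotheses (W_ge0 : forall b y, 0 <= W b y) (q_ge0 : forall b, 0 <= q b).
Hypothesis q_sum1 : Rsum B q = 1.

(** Gallager's quantities at an output [y]: [al] is the tilted joint weight, [av] its mean over the
    codeword, [c] the total over messages, and [r] the exponent rho. *)
Let al m b y := pw (P m * W b y) (1 - s).
Let av m y := Rsum B (fun b => q b * al m b y).
Let c y := Rsum A (fun m => av m y).
Let r := s / (1 - s).

(** The bound [s <= 1/2] amounts to [r <= 1], the range in which the [r]-th power is concave. *)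
Let r01 : 0 <= r <= 1.
Proof.
have s1 : 0 < 1 - s by lra.
split; first by apply: Rle_mult_inv_pos; lra.
apply: (Rmult_le_reg_r (1 - s)) => //; rewrite /r (_ : s / (1 - s) * (1 - s) = s); first lra.
by field; lra.
Qed.

Let r1 : / (1 - s) = 1 + r. Proof. by rewrite /r; field; lra. Qed.

Let al_ge0 m b y : 0 <= al m b y. Proof. exact: pw_ge0. Qed.

Let al_root m b y : P m * W b y = al m b y * pw (al m b y) r.
Proof.
rewrite -{1}(@pw1 (al m b y)) // -pwD -r1 /al pwK //; last lra.
exact: Rmult_le_pos.
Qed.

Let av_ge0 m y : 0 <= av m y.
Proof. by apply: Rsum_ge0 => b; apply: Rmult_le_pos. Qed.

Let c_ge0 y : 0 <= c y.
Proof. exact: Rsum_ge0. Qed.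

Let av0 m y : c y = 0 -> av m y = 0.
Proof.
by move=> c0; have := @Rsum_ge_term _ (av^~ y) m (av_ge0^~ y); have := av_ge0 m y; rewrite -/(c y) c0; lra.
Qed.

(** [rest] totals the weights of the competitors of [m]. [bound] multiplies the weight of [m] by the
    tangent to the [r]-th power at [c], evaluated at [rest]; being affine in [rest], it can be
    averaged exactly. *)
Let rest (e : {ffun A -> B}) m y := \big[Rplus/R0]_(m' | m' != m) al m' (e m') y.
Let bound (e : {ffun A -> B}) m y :=
  (pw (c y) r * (1 - r)) * al m (e m) y + (pw (c y) r * (r / c y)) * (al m (e m) y * rest e m y).

Let rest_ge0 (e : {ffun A -> B}) m y : 0 <= rest e m y.
Proof.
by apply: (big_ind (fun x => 0 <= x)) => // *; [lra|apply: Rplus_le_le_0_compat].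
Qed.

(** By independence the product term has mean [av m] times the sum of the other [av m'], which is at
    most [av m * c]; the coefficients [1 - r] and [r] then add up to 1. *)
Let expect_bound m y : 0 < c y -> expect q (fun e : {ffun A -> B} => bound e m y) <= pw (c y) r * av m y.
Proof.
move=> c0; rewrite /bound expectD !expectZ (expect1 q_sum1 m (fun b => al m b y)) -/(av m y).
rewrite (@expect_eq _ _ _ _ (fun e : {ffun A -> B} => \big[Rplus/R0]_(m' | m' != m) (al m (e m) y * al m' (e m') y))); last first.
  by move=> e; rewrite big_distrr.
rewrite expect_sum.
under eq_bigr => m' m'm do rewrite (expect2 q_sum1 (al m ^~ y) (al m' ^~ y) m'm) -/(av m y) -/(av m' y).
rewrite -big_distrr /=.
have h : \big[Rplus/R0]_(m' | m' != m) av m' y <= c y.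
  by rewrite /c [X in _ <= X](bigD1 m) //= -[X in X <= _]Rplus_0_l; apply: Rplus_le_compat_r.
have pwc := pw_ge0 (c y) r.
have k0 : 0 <= pw (c y) r * (r / c y) * av m y.
  apply: Rmult_le_pos => //; apply: Rmult_le_pos => //.
  by apply: Rle_mult_inv_pos => //; lra.
have := Rmult_le_compat_l _ _ _ k0 h.
have -> : pw (c y) r * (r / c y) * av m y * c y = pw (c y) r * r * av m y by field; lra.
by lra.
Qed.

Variable dec : {ffun A -> B} -> Y -> A.
Hypothesis dec_max : forall (e : {ffun A -> B}) y m, al m (e m) y <= al (dec e y) (e (dec e y)) y.

(** On an error the decoded message is a competitor of [m], so maximality gives [al m <= rest]. By
    [al_root] the error weight is [al m] times its [r]-th power, and the tangent bound applies to
    the second factor. *)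
Let err_le (e : {ffun A -> B}) m y : 0 < c y ->
  (if dec e y == m then R0 else P m * W (e m) y) <= bound e m y.
Proof.
move=> c0; have pwc := pw_ge0 (c y) r.
have bE : bound e m y = al m (e m) y * (pw (c y) r * (1 - r + r * (rest e m y / c y))).
  by rewrite /bound; field; lra.
have restc : 0 <= rest e m y / c y by apply: Rle_mult_inv_pos.
rewrite bE; case: eqP => [_|/eqP dm].
  apply: Rmult_le_pos => //; apply: Rmult_le_pos => //.
  by have := Rmult_le_pos _ _ r01.1 restc; lra.
rewrite al_root; apply: Rmult_le_compat_l => //.
apply: Rle_trans (pw_tangent r01 (al_ge0 m (e m) y) c0) _.
apply: Rmult_le_compat_l => //; apply: Rplus_le_compat_l; apply: Rmult_le_compat_l; first lra.
apply: Rmult_le_compat_r; first by apply/Rlt_le/Rinv_0_lt_compat.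
apply: Rle_trans (dec_max e y m) _.
rewrite /rest (bigD1 (dec e y)) /=; last by rewrite dm.
rewrite -[X in X <= _]Rplus_0_r; apply: Rplus_le_compat_l.
by apply: (big_ind (fun x => 0 <= x)) => // *; [lra|apply: Rplus_le_le_0_compat].
Qed.

Lemma expect_err_le y :
  expect q (fun e : {ffun A -> B} => Rsum A (fun m => if dec e y == m then R0 else P m * W (e m) y)) <=
  pw (c y) (/ (1 - s)).
Proof.
have Epw : pw (c y) (/ (1 - s)) = Rsum A (fun m => pw (c y) r * av m y).
  by rewrite r1 pwD pw1 // -Rsum_mull Rmult_comm.
rewrite Epw expect_sum; apply: Rsum_le => m.
case: (c_ge0 y) => [c0|/esym c0].
  apply: Rle_trans (expect_bound m c0); apply: expect_le => // e; exact: err_le.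
(* With [c = 0] there is no tangent point, but all means [av] vanish, so [al] is zero at every
   codeword of positive probability. *)
rewrite av0 // Rmult_0_r.
apply: Rle_trans (_ : expect q (fun e : {ffun A -> B} => al m (e m) y * pw (al m (e m) y) r) <= _).
  apply: expect_le => // e; case: eqP => _; last by rewrite al_root; lra.
  by apply: Rmult_le_pos => //; apply: pw_ge0.
rewrite (expect1 q_sum1 m (fun b => al m b y * pw (al m b y) r)).
apply: Req_le; apply: big1 => b _; rewrite -Rmult_assoc.
have := @Rsum_ge_term _ (fun b => q b * al m b y) b.
rewrite -/(av m y) av0 // => /(_ (fun b => Rmult_le_pos _ _ (q_ge0 b) (al_ge0 m b y))).
have := Rmult_le_pos _ _ (q_ge0 b) (al_ge0 m b y) => ? ?.
by rewrite (_ : q b * al m b y = 0) ?Rmult_0_l //; lra.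
Qed.

End RandomCoding.

Lemma random_coding (A B Y : finType) (P : A -> R) (W : B -> Y -> R) (q : B -> R) (s : R) (a0 : A) :
  0 < s <= / 2 -> (forall m, 0 <= P m) -> (forall b y, 0 <= W b y) ->
  (forall b, 0 <= q b) -> Rsum B q = 1 ->
  exists (e : {ffun A -> B}) (d : {ffun Y -> A}),
    Rsum A (fun m => P m * Rsum Y (fun y => if d y == m then R0 else W (e m) y)) <=
    Rsum Y (fun y => pw (Rsum A (fun m => Rsum B (fun b => q b * pw (P m * W b y) (1 - s))))
                        (/ (1 - s))).
Proof.
move=> s_bounds P_ge0 W_ge0 q_ge0 q_sum1.
have /fun_choice [dec decP] : forall ey : {ffun A -> B} * Y, exists a, forall m,
    pw (P m * W (ey.1 m) ey.2) (1 - s) <= pw (P a * W (ey.1 a) ey.2) (1 - s).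
  by move=> [e y]; apply: Rargmax a0 (fun m => pw (P m * W (e m) y) (1 - s)).
have [e eP] := expect_attained q_sum1 q_ge0 (fun e : {ffun A -> B} =>
   Rsum Y (fun y => Rsum A (fun m => if dec (e, y) == m then R0 else P m * W (e m) y))).
exists e, [ffun y => dec (e, y)]; apply: Rle_trans (Rle_trans _ _ _ eP _).
  apply: Req_le; rewrite exchange_big; apply: eq_bigr => m _ /=.
  by rewrite Rsum_mull; apply: eq_bigr => y _; rewrite ffunE; case: eqP => // _; rewrite Rmult_0_r.
rewrite expect_sum; apply: Rsum_le => y.
apply: (@expect_err_le _ _ _ P W q s _ _ _ _ _ (fun (e : {ffun A -> B}) y => dec (e, y))) => //.
by move=> e' y' m; apply: (decP (e', y')).
Qed.

(** * Sums over Markov paths *)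

Section AppendState.
Variable T : finType.

(** Splitting a path at its last state turns path sums into recursions on the length. *)
Definition fsnoc L (x : {ffun 'I_L -> T}) (t : T) : {ffun 'I_L.+1 -> T} :=
  [ffun i => if unlift ord_max i is Some j then x j else t].

Definition fbelast L (x : {ffun 'I_L.+1 -> T}) : {ffun 'I_L -> T} :=
  [ffun i => x (widen_ord (leqnSn L) i)].

Lemma widen_ord_lift L (i : 'I_L) : widen_ord (leqnSn L) i = lift ord_max i.
Proof. by apply: val_inj; rewrite /= /bump leqNgt ltn_ord. Qed.

Lemma fsnoc_widen L (x : {ffun 'I_L -> T}) t i : fsnoc x t (widen_ord (leqnSn L) i) = x i.
Proof. by rewrite ffunE widen_ord_lift liftK. Qed.

Lemma fsnoc_last L (x : {ffun 'I_L -> T}) t : fsnoc x t ord_max = t.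
Proof. by rewrite ffunE unlift_none. Qed.

Lemma fsnocK L (x : {ffun 'I_L -> T}) t : fbelast (fsnoc x t) = x.
Proof. by apply/ffunP => i; rewrite ffunE fsnoc_widen. Qed.

Lemma fbelastK L (x : {ffun 'I_L.+1 -> T}) : fsnoc (fbelast x) (x ord_max) = x.
Proof.
apply/ffunP => i; rewrite ffunE; case: unliftP => [j|] ->; last by [].
by rewrite ffunE widen_ord_lift.
Qed.

Lemma sum_fsnoc L (F : {ffun 'I_L.+1 -> T} -> R) :
  Rsum {ffun 'I_L.+1 -> T} F =
  Rsum {ffun 'I_L -> T} (fun x : {ffun 'I_L -> T} => Rsum T (fun t => F (fsnoc x t))).
Proof.
rewrite pair_bigA /= (reindex (fun p : {ffun 'I_L -> T} * T => fsnoc p.1 p.2)) //=.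
exists (fun x => (fbelast x, x ord_max)) => [[x t] _|x _] /=; last exact: fbelastK.
by rewrite fsnocK fsnoc_last.
Qed.
End AppendState.

Lemma sum_ffun0 (T : finType) (c : R) : Rsum {ffun 'I_0 -> T} (fun=> c) = c.
Proof. by rewrite Rsum_const card_ffun card_ord expn0 /= Rmult_1_l. Qed.

Section MarkovLaw.
Variables (T : finType) (P : T -> R) (W : T -> T -> R).

Lemma markov_law1 (x : {ffun 'I_1 -> T}) : markov_law P W x = P (x ord_max).
Proof. by rewrite /markov_law big_ord1; congr (P (x _)); apply: val_inj. Qed.

Lemma markov_law_snoc L (x : {ffun 'I_L.+1 -> T}) t :
  markov_law P W (fsnoc x t) = markov_law P W x * W t (x ord_max).
Proof.
rewrite /markov_law big_ord_recr /=; congr (_ * _).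
  apply: eq_bigr => i _; rewrite fsnoc_widen.
  rewrite (_ : ordpred (widen_ord (leqnSn L.+1) i) = widen_ord (leqnSn L.+1) (ordpred i)).
    by rewrite fsnoc_widen.
  exact: val_inj.
rewrite fsnoc_last (_ : ordpred _ = widen_ord (leqnSn L.+1) ord_max) ?fsnoc_widen //.
exact: val_inj.
Qed.

Hypotheses (P_ge0 : forall x, 0 <= P x) (W_ge0 : forall x y, 0 <= W x y).

Lemma markov_law_ge0 L (x : {ffun 'I_L -> T}) : 0 <= markov_law P W x.
Proof. by apply: Rprod_ge0 => i; case: ifP. Qed.

Lemma pw_markov_law p L (x : {ffun 'I_L -> T}) :
  pw (markov_law P W x) p = markov_law (fun a => pw (P a) p) (fun a b => pw (W a b) p) x.
Proof.
rewrite /markov_law pw_prod => [|i]; last by case: ifP.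
by apply: eq_bigr => i _; case: ifP.
Qed.

(** Summing out the last state replaces [v] there by [lam * v] at the state before; a path of
    [L + 1] states has [L] transitions. *)
Lemma sum_markov_law_eigen (v : T -> R) (lam : R) :
  (forall j, Rsum T (fun i => v i * W i j) = lam * v j) ->
  forall L, Rsum {ffun 'I_L.+1 -> T} (fun x : {ffun 'I_L.+1 -> T} => markov_law P W x * v (x ord_max)) =
            lam ^ L * dot v P.
Proof.
move=> vlam; elim=> [|L IH]; rewrite sum_fsnoc.
  rewrite /= Rmult_1_l -[RHS](@sum_ffun0 T); apply: eq_bigr => x _.
  by apply: eq_bigr => t _; rewrite markov_law1 fsnoc_last Rmult_comm.
rewrite /= Rmult_assoc -IH Rsum_mull; apply: eq_bigr => x _.
rewrite [markov_law P W x * _]Rmult_comm -Rmult_assoc -vlam Rsum_mulr; apply: eq_bigr => t _.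
by rewrite markov_law_snoc fsnoc_last; ring.
Qed.

Lemma sum_markov_law_le (v : T -> R) (lam : R) L :
  (forall i, 1 <= v i) -> (forall j, Rsum T (fun i => v i * W i j) = lam * v j) ->
  Rsum {ffun 'I_L.+1 -> T} (fun x => markov_law P W x) <= lam ^ L * dot v P.
Proof.
move=> v1 vlam; rewrite -(sum_markov_law_eigen vlam); apply: Rsum_le => x.
rewrite -{1}[markov_law P W x]Rmult_1_r; apply: Rmult_le_compat_l => //.
exact: markov_law_ge0.
Qed.

End MarkovLaw.

Section PairPaths.
Variables X Z : finType.

Definition fpair L (x : {ffun 'I_L -> X}) (z : {ffun 'I_L -> Z}) : {ffun 'I_L -> X * Z} :=
  [ffun i => (x i, z i)].

Lemma fpair_snoc L (x : {ffun 'I_L -> X}) (z : {ffun 'I_L -> Z}) a b :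
  fpair (fsnoc x a) (fsnoc z b) = fsnoc (fpair x z) (a, b).
Proof. by apply/ffunP => i; rewrite !ffunE; case: unlift => // j; rewrite ffunE. Qed.

Lemma sum_fpair L (F : {ffun 'I_L -> X * Z} -> R) :
  Rsum {ffun 'I_L -> X * Z} F =
  Rsum {ffun 'I_L -> X} (fun x : {ffun 'I_L -> X} =>
    Rsum {ffun 'I_L -> Z} (fun z : {ffun 'I_L -> Z} => F (fpair x z))).
Proof.
rewrite pair_bigA /=.
rewrite (reindex (fun p : {ffun 'I_L -> X} * {ffun 'I_L -> Z} => fpair p.1 p.2)) //=.
exists (fun y => ([ffun i => (y i).1], [ffun i => (y i).2])) => [[x z] _|y _] /=.
  by congr pair; apply/ffunP => i; rewrite !ffunE.
by apply/ffunP => i; rewrite !ffunE -surjective_pairing.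
Qed.

(* Sum out the x-coordinates from the last one backwards. *)
Lemma sum_markov_law_fst (P : X * Z -> R) (W : X * Z -> X * Z -> R) (S : Z -> Z -> R) :
  (forall z z' x', Rsum X (fun x => W (x, z) (x', z')) = S z z') ->
  forall L (z : {ffun 'I_L.+1 -> Z}),
  Rsum {ffun 'I_L.+1 -> X} (fun x : {ffun 'I_L.+1 -> X} => markov_law P W (fpair x z)) =
  markov_law (fun z => Rsum X (fun x => P (x, z))) S z.
Proof.
move=> WS; elim=> [|L IH] z; rewrite -(fbelastK z) sum_fsnoc.
  rewrite markov_law1 fsnoc_last -[RHS](@sum_ffun0 X); apply: eq_bigr => x _.
  by apply: eq_bigr => t _; rewrite fpair_snoc markov_law1 fsnoc_last.
rewrite markov_law_snoc -IH Rsum_mulr; apply: eq_bigr => x _.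
rewrite -(WS _ _ (x ord_max)) Rsum_mull; apply: eq_bigr => t _.
by rewrite fpair_snoc markov_law_snoc [fpair _ _ ord_max]ffunE.
Qed.

End PairPaths.

(** * Gallager's bound for the additive-noise channel *)

(** Subtraction from the [X] part of [y] is an involution of [X^n], so a sum over all codewords
    depends on the output only through its [Z] part. *)
Lemma sum_noise_of (X : finZmodType) (Z : finType) n (y : {ffun 'I_n -> X * Z})
    (F : {ffun 'I_n -> X * Z} -> R) :
  Rsum {ffun 'I_n -> X} (fun b : {ffun 'I_n -> X} => F (noise_of y b)) =
  Rsum {ffun 'I_n -> X} (fun x : {ffun 'I_n -> X} => F (fpair x [ffun i => (y i).2])).
Proof.
pose h (b : {ffun 'I_n -> X}) := [ffun i => zsub (y i).1 (b i)].
have hK : involutive h by move=> b; apply/ffunP => i; rewrite !ffunE /zsub GRing.subKr.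
rewrite [RHS](reindex_inj (inv_inj hK)); apply: eq_bigr => b _; congr F.
by apply/ffunP => i; rewrite !ffunE.
Qed.

(** Error probabilities are bounded below by 0, so the infimum exists and the [epsilon] in [Pj]
    selects it. *)
Lemma Pj_le_err_prob (M : finType) (X : finZmodType) (Z : finType)
    (PM1 : M -> R) (Ws : M -> M -> R) (PXZ1 : X * Z -> R) (Wc : X * Z -> X * Z -> R) k n
    (e : {ffun {ffun 'I_k -> M} -> {ffun 'I_n -> X}})
    (d : {ffun {ffun 'I_n -> X * Z} -> {ffun 'I_k -> M}}) :
  (forall m, 0 <= PM1 m) -> (forall m m', 0 <= Ws m m') ->
  (forall a, 0 <= PXZ1 a) -> (forall a b, 0 <= Wc a b) ->
  Pj PM1 Ws PXZ1 Wc k n <= err_prob PM1 Ws PXZ1 Wc e d.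
Proof.
move=> PM0 Ws0 PX0 Wc0.
have exE : exists r, is_inf (fun a => exists (e : {ffun {ffun 'I_k -> M} -> {ffun 'I_n -> X}})
    (d : {ffun {ffun 'I_n -> X * Z} -> {ffun 'I_k -> M}}), a = err_prob PM1 Ws PXZ1 Wc e d) r.
  apply: (@is_inf_ex _ 0); first by exists (err_prob PM1 Ws PXZ1 Wc e d), e, d.
  move=> _ [e' [d' ->]]; apply: Rsum_ge0 => m; apply: Rmult_le_pos; first exact: markov_law_ge0.
  by apply: Rsum_ge0 => y; case: ifP => _; [lra|exact: markov_law_ge0].
by apply: (epsilon_spec (inhabits R0) _ exE).1; exists e, d.
Qed.

Lemma Pj_le_gallager (M : finType) (X : finZmodType) (Z : finType)
    (PM1 : M -> R) (Ws : M -> M -> R) (PXZ1 : X * Z -> R) (Wc : X * Z -> X * Z -> R) k n s (m0 : M) :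
  (forall m, 0 <= PM1 m) -> (forall m m', 0 <= Ws m m') ->
  (forall a, 0 <= PXZ1 a) -> (forall a b, 0 <= Wc a b) -> 0 < s <= / 2 ->
  Pj PM1 Ws PXZ1 Wc k n <=
  pw (INR #|X| ^ n) (- (s / (1 - s))) *
  (pw (Rsum {ffun 'I_k -> M} (fun m => pw (markov_law PM1 Ws m) (1 - s))) (/ (1 - s)) *
   Rsum {ffun 'I_n -> Z} (fun z : {ffun 'I_n -> Z} =>
     pw (Rsum {ffun 'I_n -> X} (fun x : {ffun 'I_n -> X} =>
           pw (markov_law PXZ1 Wc (fpair x z)) (1 - s))) (/ (1 - s)))).
Proof.
move=> PM0 Ws0 PX0 Wc0 s_bounds.
pose N := INR #|{ffun 'I_n -> X}|.
have NE : N = INR #|X| ^ n by rewrite /N card_ffun card_ord; elim: n {N} => //= n <-; rewrite expnS mult_INR.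
have N0 : 0 < N.
  rewrite /N; apply/lt_0_INR/ltP/card_gt0P; exists [ffun=> GRing.zero]; by [].
have [||||e [d ed]] := @random_coding {ffun 'I_k -> M} {ffun 'I_n -> X} {ffun 'I_n -> X * Z}
   (@markov_law _ PM1 Ws k) (fun (b : {ffun 'I_n -> X}) (y : {ffun 'I_n -> X * Z}) => markov_law PXZ1 Wc (noise_of y b)) (fun=> / N) s [ffun=> m0] s_bounds.
- by move=> m; apply: markov_law_ge0.
- by move=> b y; apply: markov_law_ge0.
- by move=> b; apply/Rlt_le/Rinv_0_lt_compat.
- by rewrite Rsum_const -/N Rinv_r; lra.
apply: Rle_trans (Pj_le_err_prob e d PM0 Ws0 PX0 Wc0) (Rle_trans _ _ _ ed _).
pose Sm := Rsum {ffun 'I_k -> M} (fun m => pw (markov_law PM1 Ws m) (1 - s)).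
pose C := fun z : {ffun 'I_n -> Z} => Rsum {ffun 'I_n -> X} (fun x : {ffun 'I_n -> X} =>
           pw (markov_law PXZ1 Wc (fpair x z)) (1 - s)).
have Sm0 : 0 <= Sm by apply: Rsum_ge0 => m; apply: pw_ge0.
have C0 z : 0 <= C z by apply: Rsum_ge0 => x; apply: pw_ge0.
have iN : 0 <= / N by apply/Rlt_le/Rinv_0_lt_compat.
apply: Req_le; rewrite -NE -/Sm.
transitivity (Rsum {ffun 'I_n -> X * Z} (fun y : {ffun 'I_n -> X * Z} =>
   pw (/ N) (/ (1 - s)) * (pw Sm (/ (1 - s)) * pw (C [ffun i => (y i).2]) (/ (1 - s))))).
  apply: eq_bigr => y _; rewrite -!pwM //; last exact: Rmult_le_pos.
  congr pw; rewrite -Rmult_assoc [/ N * Sm]Rmult_comm Rmult_assoc /Sm Rsum_mulr.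
  apply: eq_bigr => m _; rewrite /C Rsum_mull Rsum_mull.
  rewrite -(sum_noise_of y (fun a => pw (markov_law PM1 Ws m) (1 - s) * (/ N * pw (markov_law PXZ1 Wc a) (1 - s)))).
  by apply: eq_bigr => b _; rewrite pwM; [ring|exact: markov_law_ge0..].
rewrite sum_fpair.
have fpairK2 (x : {ffun 'I_n -> X}) (z : {ffun 'I_n -> Z}) : [ffun i => (fpair x z i).2] = z.
  by apply/ffunP => i; rewrite !ffunE.
under eq_bigr => x _ do under eq_bigr => z _ do rewrite fpairK2.
rewrite Rsum_const -/N -!Rsum_mull.
(* The uniform codeword law gives [N^(-1/(1-s))] and the free [X] part of the output gives [N];
   together they make [N^(-s/(1-s))]. *)
have -> : pw N (- (s / (1 - s))) = N * pw (/ N) (/ (1 - s)); last by rewrite -!Rmult_assoc.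
rewrite -{2}(@pw1 N) ?[pw (/ N) _]pwE ?pwE //; try lra; last exact: Rinv_0_lt_compat.
rewrite /Rpower -exp_plus ln_Rinv //; congr exp; field; lra.
Qed.

(** * Perron-Frobenius bounds for source and channel *)

Lemma Rsum_pair (S T : finType) (F : S * T -> R) :
  Rsum (S * T)%type F = Rsum S (fun x => Rsum T (fun y => F (x, y))).
Proof. by rewrite pair_bigA; apply: eq_bigr => -[]. Qed.

(** A path of positive weight for [W] is carried by [f] to one for [A]. The identity serves for
    entrywise tilting, the projections for the reductions to [Z] or [X]. *)
Lemma irreducible_map (S T : finType) (f : S -> T) (W : S -> S -> R) (A : T -> T -> R) :
  (forall a b, 0 <= W a b) -> (forall a b, 0 <= A a b) -> (forall t, exists s, f s = t) ->
  (forall a b, 0 < W a b -> 0 < A (f a) (f b)) -> irreducible W -> irreducible A.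
Proof.
move=> W0 A0 f_surj fW W_irr x y.
have [[a <-] [b <-]] := (f_surj x, f_surj y).
have [t Wt] := W_irr a b; exists t.
elim: t b Wt => [|t IH] b /=.
  by case: eqP => [->|_]; [rewrite eqxx|lra].
move=> /Rsum_gt0_ex [u]; have := mpow_ge0 W0 t u a; have := W0 b u => Wbu Wt h.
have Wbu0 : 0 < W b u by case: Wbu => // e; move: h; rewrite -e; lra.
have Wt0 : 0 < mpow W t u a by case: Wt => // e; move: h; rewrite -e; lra.
have h0 : forall c, 0 <= A (f b) c * mpow A t c (f a).
  by move=> c; apply: Rmult_le_pos => //; apply: mpow_ge0.
have := @Rsum_ge_term _ (fun c => A (f b) c * mpow A t c (f a)) (f u) h0.
by have := Rmult_lt_0_compat _ _ (fW _ _ Wbu0) (IH _ Wt0) => /= *; lra.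
Qed.

Lemma transition_le1 (T : finType) (W : T -> T -> R) a b : is_transition W -> W a b <= 1.
Proof.
by move=> HW; rewrite -(HW b).2; apply: (@Rsum_ge_term _ (W^~ b)) => c; apply: (HW b).1.
Qed.

Lemma distr_inh (T : finType) (P : T -> R) : is_distr P -> exists x : T, 0 < P x.
Proof. by move=> [_ P1]; apply: Rsum_gt0_ex; rewrite P1; lra. Qed.

Lemma sum_le_dot (T : finType) (v w : T -> R) :
  (forall i, 1 <= v i) -> (forall i, 0 <= w i) -> Rsum T w <= dot v w.
Proof.
by move=> v1 w0; apply: Rsum_le => i; have := Rmult_le_compat_r _ _ _ (w0 i) (v1 i); lra.
Qed.

Lemma PF_spec_eig_gt0 (T : finType) (A : T -> T -> R) p i j :
  (forall i j, 0 <= A i j) -> PF_spec A p -> 0 < A i j -> 0 < p.1.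
Proof.
move=> A0 [p1 [_ peig]] Aij.
have pA l : 0 <= p.2 l * A l j by apply: Rmult_le_pos => //; have := p1 l; lra.
have := @Rsum_ge_term _ (fun l => p.2 l * A l j) i pA; rewrite peig => h.
have : 0 < p.2 i * A i j by apply: Rmult_lt_0_compat => //; have := p1 i; lra.
move=> h'; apply: Rnot_le_lt => p0; have := p1 j => pj.
by have := Rmult_le_compat_r (p.2 j) _ _ (Rle_trans _ _ _ Rle_0_1 pj) p0; lra.
Qed.

(** The eigen-equation is read at the largest entry of the eigenvector. The bound makes the supremum
    in [Hup] finite. *)
Lemma pf_eig_le_card (T : finType) (A : T -> T -> R) p (j0 : T) :
  (forall i j, A i j <= 1) -> PF_spec A p -> p.1 <= INR #|T|.
Proof.
move=> A1 [p1 [_ peig]]; have [j jP] := Rargmax j0 p.2.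
apply: (Rmult_le_reg_r (p.2 j)); first by have := p1 j; lra.
rewrite -peig -Rsum_const; apply: Rsum_le => i.
have := jP i; have := Rmult_le_compat_l (p.2 i) _ _ (Rle_trans _ _ _ Rle_0_1 (p1 i)) (A1 i j).
by lra.
Qed.

Lemma ln_le_id x : 0 <= x -> ln x <= x.
Proof.
move=> [x0|<-]; last by rewrite /ln; case: Rlt_dec => [/Rlt_irrefl|_] //; lra.
by have := exp_ineq1_le (ln x); rewrite exp_ln //; lra.
Qed.

Lemma ln_le x y : 0 < x -> x <= y -> ln x <= ln y.
Proof. by move=> x0 [xy|->]; [apply/Rlt_le/ln_increasing|lra]. Qed.

Lemma ln_powM_le (D lam dt : R) (m : nat) :
  0 < D -> 0 < lam -> 0 < dt -> D <= lam ^ m * dt -> ln D <= INR m * ln lam + ln dt.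
Proof.
move=> D0 lam0 dt0 /(ln_le D0); rewrite ln_mult ?ln_pow //; exact: pow_lt.
Qed.

(** * Source factor of the bound *)

Section Source.
Variables (M : finType) (PM1 : M -> R) (Ws : M -> M -> R) (s : R).
Hypotheses (HPM1 : is_distr PM1) (HWs : is_transition Ws) (HWs_irr : irreducible Ws).

Lemma source_bound k :
  let Sm := Rsum {ffun 'I_k.+1 -> M} (fun m => pw (markov_law PM1 Ws m) (1 - s)) in
  0 < Sm -> ln Sm <= INR k * thetaHs Ws s + xi_s PM1 Ws s.
Proof.
move=> Sm Sm0.
have [m0 _] := distr_inh HPM1.
have A0 i j : 0 <= As_mat Ws s i j by apply: pw_ge0.
have Airr : irreducible (As_mat Ws s).
  apply: (@irreducible_map _ _ idfun _ _ _ A0 _ _ HWs_irr) => [a b|t|a b ab]; first exact: (HWs b).1.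
    by exists t.
  exact: pw_gt0.
have PFA := PFP A0 Airr m0; have [p1 [_ peig]] := PFA.
apply: ln_powM_le => //.
- have [m Wm] : exists m, 0 < Ws m m0 by apply: Rsum_gt0_ex; rewrite (HWs m0).2; lra.
  by apply: (PF_spec_eig_gt0 A0 PFA (i := m) (j := m0)); apply: pw_gt0.
- have [m Pm] := distr_inh HPM1.
  have w0 i : 0 <= pw (PM1 i) (1 - s) by apply: pw_ge0.
  apply: Rlt_le_trans (sum_le_dot p1 w0).
  by apply: Rlt_le_trans (Rsum_ge_term m w0); apply: pw_gt0.
rewrite /Sm; under eq_bigr => m _ do rewrite (pw_markov_law HPM1.1 (fun a b => (HWs b).1 a)).
by apply: sum_markov_law_le => // *; apply: pw_ge0.
Qed.

End Source.

(** * Channel factor and conditional entropy *)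

Section Channel.
Variables (X : finZmodType) (Z : finType) (PXZ1 : X * Z -> R) (Wc : X * Z -> X * Z -> R) (s : R).
Hypotheses (HPXZ1 : is_distr PXZ1) (HWc : is_transition Wc) (HWc_irr : irreducible Wc).
Hypothesis s_bounds : 0 < s < 1.

Let Wc0 a b : 0 <= Wc a b. Proof. exact: (HWc b).1. Qed.

Let tilted (V : Z -> Z -> R) (a b : X * Z) := pw (Wc a b) (1 - s) * pw (V a.2 b.2) s.

Let tilted_ge0 V a b : 0 <= tilted V a b.
Proof. by apply: Rmult_le_pos; apply: pw_ge0. Qed.

Lemma tilted_irr V : admissibleV Wc V -> irreducible (tilted V).
Proof.
move=> [_ Vpos].
apply: (@irreducible_map _ _ idfun _ _ Wc0 (tilted_ge0 V) _ _ HWc_irr) => [t|[x z] [x' z'] ab].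
  by exists t.
apply: Rmult_lt_0_compat; apply: pw_gt0 => //=; apply: (Vpos z z' x').
by apply: Rlt_le_trans ab (@Rsum_ge_term _ (fun x => Wc (x, z) (x', z')) x _).
Qed.

(** The [epsilon] in [Hup] yields the supremum once the set is bounded: tilted entries are at most
    1, so the eigenvalue is at most the number of states, and [ln x <= x]. *)
Lemma Hcond_le_Hup V : admissibleV Wc V -> Hcond Wc V s <= Hup Wc s.
Proof.
move=> HV; have [a0 _] := distr_inh HPXZ1.
have is0 : 0 <= / s by apply/Rlt_le/Rinv_0_lt_compat; lra.
have [||r rP] := @is_sup_ex (fun h => exists V, admissibleV Wc V /\ h = Hcond Wc V s)
                    (/ s * INR #|{: X * Z}|).
- by exists (Hcond Wc V s), V.
- move=> _ [V' [HV' ->]]; apply: Rmult_le_compat_l => //.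
  have PFA := PFP (tilted_ge0 V') (tilted_irr HV') a0.
  have [p1 [_ peig]] := PFA.
  (* The inequality [ln x <= x] fails for negative [x], where [ln] is 0 by default. *)
  have p0 : 0 <= pf_eig (tilted V').
    case: (Rle_dec 0 (pf_eig (tilted V'))) => // /Rnot_le_lt neg.
    have := Rmult_lt_compat_r _ _ _ (Rlt_le_trans _ _ _ Rlt_0_1 (p1 a0)) neg.
    have := peig a0; have := lmul_ge0 (tilted_ge0 V') a0 (fun i => Rle_trans _ _ _ Rle_0_1 (p1 i)).
    by rewrite /lmul /pf_eig => h1 h2 h3; lra.
  apply: Rle_trans (ln_le_id p0) _; apply: pf_eig_le_card a0 _ PFA => a b.
  rewrite -[X in _ <= X]Rmult_1_r; apply: Rmult_le_compat; try exact: pw_ge0.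
    by apply: pw_le1; [lra|apply: transition_le1].
  by apply: pw_le1; [lra|apply: transition_le1 HV'.1].
have sup : is_sup (fun h => exists V, admissibleV Wc V /\ h = Hcond Wc V s) (Hup Wc s).
  exact: (epsilon_spec (inhabits R0) _ (ex_intro _ r rP)).
by apply: sup.1; exists V.
Qed.

(** The conditional entropy is a supremum, so one admissible [V] with an explicit positive
    eigenvector bounds it from below. *)
Lemma eig_le_Hup V (v : X * Z -> R) mu : admissibleV Wc V -> (forall a, 0 < v a) ->
  (forall b, Rsum _ (fun a => v a * tilted V a b) = mu * v b) -> ln mu <= s * Hup Wc s.
Proof.
move=> HV v0 veig; have [a0 _] := distr_inh HPXZ1.
rewrite -(eigenvalue_uniq a0 (tilted_ge0 V) (tilted_irr HV) v0 veig).
have -> : ln (pf_eig (tilted V)) = s * Hcond Wc V s by rewrite /Hcond /tilted; field; lra.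
by apply: Rmult_le_compat_l; [lra|exact: Hcond_le_Hup].
Qed.

Let Gn n := Rsum {ffun 'I_n -> Z} (fun z : {ffun 'I_n -> Z} =>
     pw (Rsum {ffun 'I_n -> X} (fun x : {ffun 'I_n -> X} =>
           pw (markov_law PXZ1 Wc (fpair x z)) (1 - s))) (/ (1 - s))).

(** The state [x' = 0] is the reference used in [K_mat]; in case (i) it may be exchanged for any
    other. *)
Let S z z' := Rsum X (fun x => pw (Wc (x, z) (GRing.zero, z')) (1 - s)).

Let S_ge0 z z' : 0 <= S z z'. Proof. by apply: Rsum_ge0 => x; apply: pw_ge0. Qed.

Let pwK_mat z z' : pw (K_mat Wc s z z') (1 - s) = S z z'.
Proof. by rewrite /K_mat pw_pw Rinv_l; [apply: pw1; apply: S_ge0|lra]. Qed.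

Lemma K_mat_gt0 : assumption2_i Wc ->
  forall x z x' z', 0 < Wc (x, z) (x', z') -> 0 < K_mat Wc s z z'.
Proof.
move=> HA x z x' z' Wxz; apply: pw_gt0; rewrite (HA s _ z z' _ x'); last lra.
apply: Rlt_le_trans (_ : pw (Wc (x, z) (x', z')) (1 - s) <= _); first exact: pw_gt0.
by apply: (@Rsum_ge_term _ (fun x => pw (Wc (x, z) (x', z')) (1 - s))) => ?; apply: pw_ge0.
Qed.

Lemma channel_bound_i n : assumption2_i Wc -> 0 < Gn n.+1 ->
  (1 - s) * ln (Gn n.+1) <= INR n * (s * Hup Wc s) + xi_c PXZ1 Wc s.
Proof.
move=> HA G0; rewrite /xi_c; case: (excluded_middle_informative (assumption2_i Wc)) => [p|/(_ HA) //]; rewrite [is_left _]/=.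
set w := fun z => pw (Rsum X (fun x => pw (PXZ1 (x, z)) (1 - s))) (/ (1 - s)).
pose K := K_mat Wc s; have K0 z z' : 0 <= K z z' by apply: pw_ge0.
have w0 z : 0 <= w z by apply: pw_ge0.
have [[x0 z0] _] := distr_inh HPXZ1.
have Kirr : irreducible K.
  apply: (@irreducible_map _ _ snd _ _ Wc0 K0 _ _ HWc_irr) => [z|[x z] [x' z']].
    by exists (x0, z).
  exact: K_mat_gt0.
have PFK := PFP K0 Kirr z0.
rewrite -/K; set v := pf_vec K; pose lam := pf_eig K.
have v1 : forall z, 1 <= v z := PFK.1.
have veig : forall z', Rsum Z (fun z => v z * K z z') = lam * v z' := PFK.2.2.
have v0 z : 0 < v z by have := v1 z; lra.
have Kcol z' : exists z, 0 < K z z'.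
  have [[x z] Wxz] : exists a, 0 < Wc a (x0, z').
    by apply: Rsum_gt0_ex; rewrite (HWc (x0, z')).2; lra.
  by exists z; apply: K_mat_gt0 Wxz.
have lam0 : 0 < lam by have [z Kz] := Kcol z0; apply: PF_spec_eig_gt0 K0 PFK Kz.
(* This makes [ln (dot v w)] nonnegative, hence at least [1 - s] times itself in the final
   estimate. *)
have dot1 : 1 <= dot v w.
  apply: Rle_trans (sum_le_dot v1 w0); rewrite -HPXZ1.2 Rsum_pair exchange_big.
  by apply: Rsum_le => z; apply: Rsum_le_pw_sum => [|x]; [lra|apply: HPXZ1.1].
have lnG : ln (Gn n.+1) <= INR n * ln lam + ln (dot v w).
  apply: ln_powM_le => //; first lra.
  apply: Rle_trans (sum_markov_law_le w0 K0 n v1 veig); apply: Req_le; apply: eq_bigr => z _.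
  under eq_bigr => x _ do rewrite (pw_markov_law HPXZ1.1 Wc0).
  (* By (i) the sum over [x] paths collapses to a chain on [Z] driven by [S], and the outer power
     turns [S] into [K]. *)
  rewrite (@sum_markov_law_fst _ _ _ _ S) => [|? ? ?]; last by apply: HA; lra.
  by rewrite pw_markov_law // => z1; apply: Rsum_ge0 => ?; apply: pw_ge0.
have Hup_ge : (1 - s) * ln lam <= s * Hup Wc s.
  (* Doob transform of [K]: its columns sum to 1 by the eigen-equation. *)
  pose V z z' := v z * K z z' * / (lam * v z').
  have lv z : 0 < lam * v z by apply: Rmult_lt_0_compat.
  have HV : admissibleV Wc V.
    split=> [z'|z z' x' /Rsum_gt0_ex [x Wxz]]; first split=> [z|].
    - apply: Rmult_le_pos; first by apply: Rmult_le_pos => //; apply: Rlt_le.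
      exact/Rlt_le/Rinv_0_lt_compat.
    - by rewrite -Rsum_mulr veig Rinv_r //; have := lv z'; lra.
    apply: Rmult_lt_0_compat; last exact: Rinv_0_lt_compat.
    by apply: Rmult_lt_0_compat => //; apply: K_mat_gt0 Wxz.
  (* The eigenvector is [v^(1-s)] with eigenvalue [lam^(1-s)]: summing over [x] gives [K^(1-s)], and
     [V^s] supplies the missing powers [v^s] and [K^s]. *)
  rewrite -ln_pw //; apply: (eig_le_Hup (v := fun a => pw (v a.2) (1 - s)) HV) => [a|[x' z']].
    exact: pw_gt0.
  rewrite Rsum_pair exchange_big /=.
  set c := / (lam * v z'); have c0 : 0 < c by apply: Rinv_0_lt_compat.
  transitivity (Rsum Z (fun z => pw c s * (v z * K z z'))).
    apply: eq_bigr => z _; rewrite /tilted /=.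
    transitivity (pw (v z) (1 - s) * pw (V z z') s * S z z').
      by rewrite /S (HA s _ z z' _ x') ?Rsum_mull; [apply: eq_bigr => x _; ring|lra].
    have pw_split a : 0 <= a -> a = pw a (1 - s) * pw a s.
      by move=> a_ge0; rewrite -pwD (_ : 1 - s + s = 1) ?pw1 //; ring.
    rewrite -pwK_mat -/K /V -/c pwM; [|apply: Rmult_le_pos => //|]; try exact: Rlt_le.
    rewrite pwM //; last exact: Rlt_le.
    by rewrite [X in pw c s * X](_ : _ = (pw (v z) (1 - s) * pw (v z) s) * (pw (K z z') (1 - s) * pw (K z z') s));
       [ring | rewrite -!pw_split //; exact: Rlt_le].
  rewrite -Rsum_mull veig -pwM; try exact: Rlt_le.
  rewrite -{1}(@pw1 (lam * v z')); last exact: Rlt_le.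
  rewrite [X in pw (lam * _) X](_ : 1 = s + (1 - s)); last ring.
  rewrite pwD -Rmult_assoc -pwM; try exact: Rlt_le.
  by rewrite /c Rinv_l ?pw1l ?Rmult_1_l //; have := lv z'; lra.
have lndot : 0 <= ln (dot v w) by rewrite -ln_1; apply: ln_le; lra.
have := Rmult_le_compat_l (1 - s) _ _ _ lnG; have := Rmult_le_compat_l (INR n) _ _ (pos_INR n) Hup_ge.
by have := Rmult_le_pos s _ _ lndot; lra.
Qed.

Lemma channel_bound_ii n : #|Z| = 1%nat -> ~ assumption2_i Wc -> 0 < Gn n.+1 ->
  (1 - s) * ln (Gn n.+1) <= INR n * (s * Hup Wc s) + xi_c PXZ1 Wc s.
Proof.
move=> Z1 nHA G0; rewrite /xi_c; case: (excluded_middle_informative (assumption2_i Wc)) => [/nHA //|p]; rewrite [is_left _]/=.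
have [[x0 z1] _] := distr_inh HPXZ1.
case: pickP => [z0 _|/(_ z1)] //.
have Zz0 z : z = z0 by have /fintype_le1P := eq_leq Z1; apply.
have sumZ (F : Z -> R) : Rsum Z F = F z0.
  by rewrite (big_pred1 z0) // => z; apply/esym/eqP/Zz0.
pose Bm (x x' : X) := pw (Wc (x, z0) (x', z0)) (1 - s).
have B0 x x' : 0 <= Bm x x' by apply: pw_ge0.
pose w x := pw (PXZ1 (x, z0)) (1 - s).
have w0 x : 0 <= w x by apply: pw_ge0.
have Birr : irreducible Bm.
  apply: (@irreducible_map _ _ fst _ _ Wc0 B0 _ _ HWc_irr) => [x|[x z] [x' z']].
    by exists (x, z0).
  by rewrite (Zz0 z) (Zz0 z'); apply: pw_gt0.
have PFB := PFP B0 Birr x0.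
rewrite -/Bm -/w; set v := pf_vec Bm; pose lam := pf_eig Bm.
have v1 : forall x, 1 <= v x := PFB.1.
have veig : forall x', Rsum X (fun x => v x * Bm x x') = lam * v x' := PFB.2.2.
have v0 x : 0 < v x by have := v1 x; lra.
have lam0 : 0 < lam.
  have [[x z] Wxz] : exists a, 0 < Wc a (x0, z0).
    by apply: Rsum_gt0_ex; rewrite (HWc (x0, z0)).2; lra.
  by apply: (PF_spec_eig_gt0 B0 PFB (i := x) (j := x0)); apply: pw_gt0; rewrite -{1}(Zz0 z).
have dot0 : 0 < dot v w.
  have [[x z] Px] := distr_inh HPXZ1.
  apply: Rlt_le_trans (sum_le_dot v1 w0); apply: Rlt_le_trans (Rsum_ge_term x w0).
  by apply: pw_gt0; rewrite -(Zz0 z).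
pose Cm := Rsum {ffun 'I_n.+1 -> X} (fun x => markov_law w Bm x).
(* There is only one [z] path, so the channel factor is a single power, whose exponent cancels the
   factor [1 - s]. *)
have GE : Gn n.+1 = pw Cm (/ (1 - s)).
  rewrite /Gn (big_pred1 [ffun=> z0]) => [|z]; last first.
    by apply/esym/eqP/ffunP => i; rewrite ffunE.
  congr pw; apply: eq_bigr => x _; rewrite (pw_markov_law HPXZ1.1 Wc0).
  by apply: eq_bigr => i _; rewrite !ffunE.
have Cm0 : 0 < Cm.
  apply: Rnot_le_lt => Cm0; move: G0; rewrite GE pw0 //; lra.
have lnC : ln Cm <= INR n * ln lam + ln (dot v w).
  by apply: ln_powM_le => //; apply: sum_markov_law_le.
have Hup_ge : ln lam <= s * Hup Wc s.
  (* On a one-point [Z] the constant 1 is a transition matrix, and the tilted matrix reduces to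
     [Bm]. *)
  have HV : admissibleV Wc (fun _ _ => 1).
    split=> [z'|*]; last lra.
    by split=> [*|]; [lra|rewrite sumZ].
  apply: (eig_le_Hup (v := fun a => v a.1) HV) => [a|[x' z']] //=.
  rewrite -veig Rsum_pair /=.
  by apply: eq_bigr => x _; rewrite sumZ /tilted pw1l Rmult_1_r (Zz0 z').
rewrite GE ln_pw // -Rmult_assoc Rinv_r ?Rmult_1_l; last lra.
by have := Rmult_le_compat_l (INR n) _ _ (pos_INR n) Hup_ge; lra.
Qed.

Lemma channel_bound n : assumption2 Wc -> 0 < Gn n.+1 ->
  (1 - s) * ln (Gn n.+1) <= INR n * (s * Hup Wc s) + xi_c PXZ1 Wc s.
Proof.
move=> HA2; case: (classic (assumption2_i Wc)) => HA; first exact: channel_bound_i.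
by case: HA2 => // Z1; apply: channel_bound_ii.
Qed.

End Channel.

(** * Combination of the source and channel bounds *)

(** A bound by the infimum is a bound for each [s]. Positivity of [Pj] sets aside the case of
    logarithm minus infinity, for which [ln] would return 0. *)
Theorem mainTheorem11 (M : finType) (X : finZmodType) (Z : finType)
  (PM1 : M -> R) (Ws : M -> M -> R) (PXZ1 : X * Z -> R) (Wc : X * Z -> X * Z -> R)
  (HPM1 : is_distr PM1) (HWs : is_transition Ws)
  (HWs_irr : irreducible Ws) (HWs_ap : aperiodic Ws)
  (HPXZ1 : is_distr PXZ1) (HWc : is_transition Wc)
  (HWc_irr : irreducible Wc) (HWc_ap : aperiodic Wc)
  (HA2 : assumption2 Wc)
  (k n : nat) (Hk : leq 2 k) (Hn : leq 2 n) :
  forall s : R, 0 < s -> s <= / 2 ->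
    0 < Pj PM1 Ws PXZ1 Wc k n ->
    ln (Pj PM1 Ws PXZ1 Wc k n) <=
      (- (INR n * s * ln (INR #|X|))
        + (INR n - 1) * Ufun Ws Wc ((INR k - 1) / (INR n - 1)) s) / (1 - s)
      + (xi_s PM1 Ws s + xi_c PXZ1 Wc s) / (1 - s).
Proof.
move=> s s0 s_half Pj0.
have [m0 _] := distr_inh HPM1; have [a0 _] := distr_inh HPXZ1.
have s_bounds : 0 < s < 1 by lra.
case: k Hk Pj0 => // k' _; case: n Hn => // n' Hn Pj0.
(* Positivity of [n - 1] lets the ratio inside [Ufun] cancel against its prefactor. *)
have n'0 : 0 < INR n' by apply/lt_0_INR/ltP.
have := Pj_le_gallager k'.+1 n'.+1 m0 HPM1.1 (fun a b => (HWs b).1 a) HPXZ1.1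
          (fun a b => (HWc b).1 a) (conj s0 s_half).
set Sm := (X in pw X (/ (1 - s)) * _); set G := (X in _ * (_ * X)) => PjG.
have X0 : 0 < INR #|X| by apply/lt_0_INR/ltP/card_gt0P; exists a0.1.
have NX0 : 0 < INR #|X| ^ n'.+1 by apply: pow_lt.
have pN := pw_gt0 (- (s / (1 - s))) NX0.
(* Both factors must be positive for their logarithms; otherwise Gallager's bound would contradict
   [0 < Pj]. *)
have [G0|G0] : 0 < G \/ G <= 0 by case: (Rlt_dec 0 G) => ?; [left|right]; lra.
  have [Sm0|Sm0] : 0 < Sm \/ Sm <= 0 by case: (Rlt_dec 0 Sm) => ?; [left|right]; lra.
    have pS := pw_gt0 (/ (1 - s)) Sm0.
    have := ln_le Pj0 PjG.
    rewrite ln_mult //; last exact: Rmult_lt_0_compat.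
    rewrite ln_mult // !ln_pw // ln_pow //.
    have hS := source_bound HPM1 HWs HWs_irr Sm0.
    have hG := channel_bound HPXZ1 HWc HWc_irr s_bounds HA2 G0.
    move=> h; apply: Rle_trans h _.
    set lX := ln (INR #|X|); set lS := ln Sm; set lG := ln G.
    rewrite /Ufun !S_INR.
    have i0 : 0 <= / (1 - s) by apply/Rlt_le/Rinv_0_lt_compat; lra.
    (* The channel factor carries no outer exponent, hence the weight [1 - s] on its logarithm over
       the common denominator. *)
    apply: Rle_trans (_ : / (1 - s) * (- ((INR n' + 1) * s * lX) + lS + (1 - s) * lG) <= _).
      by apply: Req_le; field; lra.
    rewrite (_ : _ / (1 - s) + _ = / (1 - s) * (- ((INR n' + 1) * s * lX)
       + (INR k' * thetaHs Ws s + xi_s PM1 Ws s) + (INR n' * (s * Hup Wc s) + xi_c PXZ1 Wc s))).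
      by apply: Rmult_le_compat_l => //; rewrite -/lS in hS; rewrite -/lG in hG; lra.
    by field; lra.
  by move: PjG; rewrite (pw0 _ Sm0); lra.
have pS := pw_ge0 Sm (/ (1 - s)).
have := Rmult_le_compat_l _ _ _ (Rmult_le_pos _ _ (Rlt_le _ _ pN) pS) G0; lra.
Qed.
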